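(* Let $(D,\{\mu_{k,[r]}\}_{k\ge1,[r]\in C_k})$ be a $Dend_\infty[1]$-algebra over a field of characteristic $0$. Then $(D,\{\theta_k\}_{k\ge1})$ is a $pre\text{-}Lie_\infty[1]$-algebra, where $$\theta_k(a_1,\ldots,a_k)=\sum_{\sigma\in S_k}\epsilon(\sigma)\,\mu_{k,[\sigma^{-1}(k)]}(a_{\sigma(1)},\ldots,a_{\sigma(k)}),\quad k\ge1,$$ and $\epsilon(\sigma)=\epsilon(\sigma;a_1,\ldots,a_k)$ is the Koszul sign.
   Context: Let $C_k=\{[1],\ldots,[k]\}$. A $Dend_\infty[1]$-algebra is a graded vector space $D$ with degree $1$ maps $\mu_{k,[r]}:D^{\otimes k}\to D$ for $k\ge1$, $[r]\in C_k$, such that for every $n\ge1$, $[r]\in C_n$ and homogeneous $a_1,\ldots,a_n\in D$, $$\sum_{k+l=n+1}\sum_{i=1}^k(-1)^{|a_1|+\cdots+|a_{i-1}|}\,\mu_{k,R_0[r]}\big(a_1,\ldots,a_{i-1},\mu_{l,R_i[r]}(a_i,\ldots,a_{i+l-1}),a_{i+l},\ldots,a_n\big)=0,$$ where (depending on $k,l,i$): if $1\le r\le i-1$, $R_0[r]=[r]$ and $R_i[r]=[1]+\cdots+[l]$; if $i\le r\le i+l-1$, $R_0[r]=[i]$ and $R_i[r]=[r-i+1]$; if $i+l\le r\le k+l-1$, $R_0[r]=[r-l+1]$ and $R_i[r]=[1]+\cdots+[l]$; and $\mu_{l,[1]+\cdots+[l]}=\mu_{l,[1]}+\cdots+\mu_{l,[l]}$.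 (This is the explicit form of the Maurer-Cartan equation in the graded Lie algebra used to define $Dend_\infty[1]$-algebras.) A $pre\text{-}Lie_\infty[1]$-algebra (a Maurer-Cartan element for the Matsushima-Nijenhuis bracket on $\bigoplus_n\mathrm{Hom}_n(S(W)\otimes W,W)$) is, explicitly, a graded vector space $W$ with degree $1$ maps $\theta_k:W^{\otimes k}\to W$, $k\ge1$, graded symmetric in the first $k-1$ arguments, such that for all $n\ge1$ and homogeneous $v_1,\ldots,v_n\in W$, $$\sum_{\substack{i+j=n+1\\ i\ge1,\,j\ge2}}\ \sum_{\sigma\in S_{(i-1,1,j-2)}}\epsilon(\sigma)\,\theta_j\big(\theta_i(v_{\sigma(1)},\ldots,v_{\sigma(i-1)},v_{\sigma(i)}),v_{\sigma(i+1)},\ldots,v_{\sigma(n-1)},v_n\big)$$ $$+\sum_{\substack{i+j=n+1\\ i\ge1,\,j\ge1}}\ \sum_{\sigma\in S_{(j-1,i-1)}}(-1)^{|v_{\sigma(1)}|+\cdots+|v_{\sigma(j-1)}|}\epsilon(\sigma)\,\theta_j\big(v_{\sigma(1)},\ldots,v_{\sigma(j-1)},\theta_i(v_{\sigma(j)},\ldots,v_{\sigma(n-1)},v_n)\big)=0,$$ where the sums are over shuffles in $S_{n-1}$ acting on $v_1,\ldots,v_{n-1}$ ($S_{(p,q,s)}$: permutations increasing on each of the consecutive blocks of sizes $p,q,s$), and $\epsilon(\sigma)$ is the Koszul sign. *)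

(* Defs.v *)
From HB Require Import structures.
From mathcomp Require Import all_boot all_order all_algebra all_fingroup.
From mathcomp Require Import all_classical.

Set Implicit Arguments.
Unset Strict Implicit.
Unset Printing Implicit Defensive.

Import Order.TTheory GRing.Theory Num.Theory.
Local Open Scope ring_scope.

(* A Z-graded vector space, as the internal direct sum of its homogeneous
   components.  The decomposition is given by the projections
   [hcomp d : D -> D] onto the components of degree [d]. *)
Record gradedSpace (K : fieldType) := GradedSpace {
  gsort :> lmodType K;
  hcomp : int -> {linear gsort -> gsort};
  hcompK : forall d e x, hcomp d (hcomp e x) = if d == e then hcomp e x else 0;
  hcomp_finite : forall x, finite_set [set d | hcomp d x != 0]%classic;
  hcomp_sum : forall x, x = \sum_(d \in [set: int]%classic) hcomp d x
}.

(* [homog d x] : x lies in the component of degree d (0 lies in all of them). *)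
Definition homog (K : fieldType) (D : gradedSpace K) (d : int) (x : D) : Prop :=
  hcomp D d x = x.

Section Operations.
Variables (K : fieldType) (D : gradedSpace K).

Definition op (k : nat) : Type := {ffun 'I_k -> D} -> D.

Definition subst_arg k (a : {ffun 'I_k -> D}) (j : 'I_k) (x : D) :
    {ffun 'I_k -> D} :=
  [ffun i => if i == j then x else a i].

Definition multilinear k (f : op k) : Prop :=
  forall (a : {ffun 'I_k -> D}) (j : 'I_k) (c : K) (x y : D),
    f (subst_arg a j (c *: x + y)) =
    c *: f (subst_arg a j x) + f (subst_arg a j y).

Definition degree_one k (f : op k) : Prop :=
  forall (d : 'I_k -> int) (a : {ffun 'I_k -> D}),
    (forall i, homog (d i) (a i)) -> homog (1 + \sum_i d i) (f a).

(* Extension to D^k, by additivity, of an expression [f d a] given for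
   arguments a_i homogeneous of degree d_i. *)
Definition hextend k (f : {ffun 'I_k -> int} -> op k) : op k :=
  fun a => \sum_(d \in [set: {ffun 'I_k -> int}]%classic)
             f d [ffun i => hcomp D (d i) (a i)].

Lemma hextendE k (f : {ffun 'I_k -> int} -> op k) (d : {ffun 'I_k -> int})
    (a : {ffun 'I_k -> D}) :
    (forall e (b : {ffun 'I_k -> D}) i, b i = 0 -> f e b = 0) ->
    (forall i, homog (d i) (a i)) -> hextend f a = f d a.
Proof.
move=> f0 ad; rewrite /hextend -(fsbig_widen [set d]%classic) //=.
  rewrite fsbig_set1; congr (f d _); apply/ffunP => i.
  by rewrite ffunE; exact: ad.
move=> e /= [_ /eqP ed].
have [i edi] : exists i, e i != d i.
  apply/existsP; apply: contraNT ed => /existsPn h; apply/eqP/ffunP => i.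
  by apply/eqP; move/negPn: (h i).
by apply: (f0 _ _ i); rewrite ffunE -(ad i) hcompK (negPf edi).
Qed.

(* Finite argument lists are taken from sequences b : nat -> D indexed from 1:
   [app f b] is f(b_1, ..., b_k). *)
Definition app k (f : op k) (b : nat -> D) : D := f [ffun i : 'I_k => b i.+1].

(* f(b_1, ..., b_{i-1}, g(b_i, ..., b_{i+l-1}), b_{i+l}, ..., b_{k+l-1}) *)
Definition insert_at k l (i : nat) (f : op k) (g : op l) (b : nat -> D) : D :=
  app f (fun j => if (j < i)%N then b j
                  else if j == i then app g (fun t => b (i + t - 1)%N)
                  else b (j + l - 1)%N).

Definition homog_upto (n : nat) (d : nat -> int) (b : nat -> D) : Prop :=
  forall i, (1 <= i <= n)%N -> homog (d i) (b i).

(* The action of a permutation of {1, ..., m} (encoded on 'I_m) on positive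
   integers; it fixes all i > m. *)
Definition perm_act m (s : 'S_m) (i : nat) : nat :=
  if i is j.+1 then (if insub j is Some x then (s x).+1 else i) else 0.

(* The Koszul sign: a_1 ... a_n = koszul s d * a_(s 1) ... a_(s n) in the
   graded symmetric algebra, where |a_i| = d_i. *)
Definition koszul n (s : 'S_n) (d : 'I_n -> int) : K :=
  \prod_(i < n) \prod_(j < n | (i < j)%N && (s j < s i)%N)
     (-1) ^ (d (s i) * d (s j)).

(* [c] lists the sizes of the consecutive blocks. *)
Definition shuffle m (c : seq nat) (s : 'S_m) : bool :=
  [forall x : 'I_m, forall y : 'I_m,
     (x < y)%N && (reshape_index c x == reshape_index c y) ==> (s x < s y)%N].

(* The label [r] in C_k is encoded by the natural number r, 1 <= r <= k; the
   values of operations at other labels are irrelevant and never used. *)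
Definition labelR0 (l i r : nat) : nat :=
  if (r < i)%N then r else if (r < i + l)%N then i else (r - l + 1)%N.

(* A sum of labels is encoded by the list of its terms. *)
Definition labelRi (l i r : nat) : seq nat :=
  if (i <= r < i + l)%N then [:: (r - i + 1)%N] else iota 1 l.

Definition sum_labels (mu : forall k, nat -> op k) l (R : seq nat) : op l :=
  fun a => \sum_(t <- R) mu l t a.

Record dend_infty1 (mu : forall k, nat -> op k) : Prop := DendInfty1 {
  dend_multilinear : forall k r, (1 <= r <= k)%N -> multilinear (mu k r);
  dend_degree : forall k r, (1 <= r <= k)%N -> degree_one (mu k r);
  dend_identity : forall (n r : nat) (d : nat -> int) (a : nat -> D),
    (1 <= r <= n)%N -> homog_upto n d a ->
    \sum_(1 <= k < n.+1) \sum_(1 <= l < n.+1 | (k + l == n + 1)%N)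
      \sum_(1 <= i < k.+1)
        (-1) ^ (\sum_(1 <= t < i) d t) *:
          insert_at i (mu k (labelR0 l i r))
            (sum_labels mu (l := l) (labelRi l i r)) a = 0
}.

(* The arity-0 component of [theta] is irrelevant. In both sums of the identity
   the permutations of {1, ..., n-1} act on v_1, ..., v_n fixing v_n. *)
Record pre_lie_infty1 (theta : forall k, op k) : Prop := PreLieInfty1 {
  pre_lie_multilinear : forall k, (1 <= k)%N -> multilinear (theta k);
  pre_lie_degree : forall k, (1 <= k)%N -> degree_one (theta k);
  pre_lie_symmetric : forall (k : nat) (d : nat -> int) (v : nat -> D)
      (s : 'S_k.-1), (1 <= k)%N -> homog_upto k d v ->
    app (theta k) v =
    koszul s (fun x => d x.+1) *: app (theta k) (v \o perm_act s);
  pre_lie_identity : forall (n : nat) (d : nat -> int) (v : nat -> D),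
    (1 <= n)%N -> homog_upto n d v ->
    \sum_(1 <= i < n.+1) \sum_(2 <= j < n.+1 | (i + j == n + 1)%N)
      \sum_(s : 'S_n.-1 | shuffle [:: i - 1; 1; j - 2]%N s)
        koszul s (fun x => d x.+1) *:
          insert_at 1 (theta j) (theta i) (v \o perm_act s)
    + \sum_(1 <= i < n.+1) \sum_(1 <= j < n.+1 | (i + j == n + 1)%N)
      \sum_(s : 'S_n.-1 | shuffle [:: j - 1; i - 1]%N s)
        ((-1) ^ (\sum_(1 <= t < j) d (perm_act s t))
           * koszul s (fun x => d x.+1)) *:
          insert_at j (theta j) (theta i) (v \o perm_act s) = 0
}.

Definition theta_of_dend (mu : forall k, nat -> op k) (k : nat) : op k :=
  match k with
  | 0 => fun=> 0
  | m.+1 => hextend (fun (d : {ffun 'I_m.+1 -> int}) a =>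
      \sum_(s : 'S_m.+1)
        koszul s d *: mu m.+1 ((s^-1)%g ord_max).+1 [ffun i => a (s i)])
  end.

Lemma multilinear0 k (f : op k) (a : {ffun 'I_k -> D}) i :
  multilinear f -> a i = 0 -> f a = 0.
Proof.
move=> /(_ a i 1 0 0) + ai; have -> : subst_arg a i (1 *: 0 + 0) = a.
  by apply/ffunP => j; rewrite ffunE scaler0 addr0; case: eqVneq => // ->.
have -> : subst_arg a i 0 = a.
  by apply/ffunP => j; rewrite ffunE; case: eqVneq => // ->.
by rewrite scale1r => /eqP; rewrite -subr_eq0 opprD addNKr oppr_eq0 => /eqP.
Qed.

(* [theta_of_dend mu] is given by the expected formula on homogeneous
   arguments. *)
Lemma theta_of_dendE (mu : forall k, nat -> op k) m
    (d : {ffun 'I_m.+1 -> int}) (a : {ffun 'I_m.+1 -> D}) :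
  dend_infty1 mu -> (forall i, homog (d i) (a i)) ->
  theta_of_dend mu a =
  \sum_(s : 'S_m.+1)
    koszul s d *: mu m.+1 ((s^-1)%g ord_max).+1 [ffun i => a (s i)].
Proof.
move=> muP ad; apply: hextendE => // e b i bi0.
rewrite big1 // => s _; rewrite (@multilinear0 _ _ _ ((s^-1)%g i)).
- by rewrite scaler0.
- by apply: dend_multilinear muP _ _ _; rewrite /= ltn_ord.
- by rewrite ffunE permKV.
Qed.

End Operations.

(* Main.v *)
(* Let a permutation act on operations by permuting the arguments with Koszul
   signs, so that theta_k is the sum over S_k of the translates of the mu_k's.
   Inserting the translate of g by t into slot q of the translate of f by s gives
   the translate, by a permutation b(s, t) that blows up one letter of s to a
   block permuted by t, of the insertion of g into slot s^-1(q) of f; the signs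
   match since moving an operation of degree one past letters is counted on
   both sides.
   In the pre-Lie identity the inner operation sits in the slot q = 1 or q = k.
   The summand, as a function on the permutations fixing n, is invariant under
   the Young subgroup of its blocks, which consists of those b(s, t) for which s
   fixes q and k and t fixes l; so, up to the order of that subgroup, the sum over
   shuffles is the sum over all permutations fixing n. After expansion, s' b(s, t)
   runs, for fixed s and t, over the permutations sigma for which sigma^-1(n) is a
   prescribed position; each choice of the outer slot and of the two labels arises
   from as many pairs (s, t) as the Young subgroup has elements. In
   characteristic 0 the two factors cancel, and what is left is the sum over sigma
   of the dendriform identity with r = sigma^-1(n): q = k gives the terms whose
   inner block contains the r-th letter, q = 1 the others. *)

Require Import Defs.
From mathcomp Require Import all_boot all_order all_algebra all_fingroup.
From mathcomp Require Import all_classical.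
From mathcomp Require Import zify ring.

Set Implicit Arguments.
Unset Strict Implicit.
Unset Printing Implicit Defensive.

Import Order.TTheory GRing.Theory Num.Theory.
Local Open Scope ring_scope.

(** * Permutations as functions on positive integers *)

Local Notation pa := perm_act.

Lemma perm_act_ord m (s : 'S_m) (i : 'I_m) : pa s i.+1 = (s i).+1.
Proof. by rewrite /= valK. Qed.

Lemma perm_act_in m x : (1 <= x <= m)%N -> exists i : 'I_m, x = i.+1.
Proof.
by case: x => // x /andP[_ lx]; exists (Ordinal lx).
Qed.

Lemma perm_act_out m (s : 'S_m) x : (m < x)%N -> pa s x = x.
Proof. by case: x => //= x lx; rewrite insubF //; apply/negbTE; lia. Qed.

Arguments perm_act : simpl never.

Lemma perm_act_range m (s : 'S_m) x : (1 <= pa s x <= m)%N = (1 <= x <= m)%N.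
Proof.
have [/perm_act_in[i ->]|] := boolP (1 <= x <= m)%N.
  by rewrite perm_act_ord; have := ltn_ord (s i); lia.
case: x => // x; rewrite -ltnNge /= => lx; have := @perm_act_out m s x.+1 lx.
by move=> /= ->; lia.
Qed.

Lemma perm_act1 m x : pa (1%g : 'S_m) x = x.
Proof.
case: (ltnP m x) => [/perm_act_out->//|]; case: x => // x lx.
by have [//|i ->] := @perm_act_in m x.+1; rewrite perm_act_ord perm1.
Qed.

Lemma perm_actM m (s t : 'S_m) x : pa (s * t)%g x = pa t (pa s x).
Proof.
case: (ltnP m x) => [lx|]; first by rewrite !perm_act_out.
case: x => // x lx; have [//|i ->] := @perm_act_in m x.+1.
by rewrite !perm_act_ord permM.
Qed.

Lemma perm_actK m (s : 'S_m) : cancel (pa s) (pa s^-1%g).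
Proof. by move=> x; rewrite -perm_actM mulgV perm_act1. Qed.

Lemma perm_actKV m (s : 'S_m) : cancel (pa s^-1%g) (pa s).
Proof. by move=> x; rewrite -perm_actM mulVg perm_act1. Qed.

Lemma perm_act_inj m (s : 'S_m) : injective (pa s).
Proof. exact: can_inj (perm_actK s). Qed.

Lemma perm_act_eqV m (s : 'S_m) x y : (pa s x == y) = (x == pa s^-1%g y).
Proof. by apply/eqP/eqP => [<-|->]; rewrite ?perm_actK ?perm_actKV. Qed.

Lemma perm_act_eq m (s t : 'S_m) :
  (forall x, (1 <= x <= m)%N -> pa s x = pa t x) -> s = t.
Proof.
move=> h; apply/permP => i; apply/val_inj; have := h i.+1.
by rewrite !perm_act_ord ltn_ord => /(_ isT)[].
Qed.

(* The identity when [f] does not permute {1, ..., n}. *)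
Definition perm_of_fun n (f : nat -> nat) : 'S_n :=
  odflt 1%g [pick s : 'S_n | [forall i, (s i).+1 == f i.+1]].

Lemma perm_of_funE n (f : nat -> nat) :
  (forall x, (1 <= x <= n)%N -> (1 <= f x <= n)%N) ->
  (forall x y, (1 <= x <= n)%N -> (1 <= y <= n)%N -> f x = f y -> x = y) ->
  forall x, (1 <= x <= n)%N -> pa (perm_of_fun n f) x = f x.
Proof.
move=> fr finj x hx; rewrite /perm_of_fun; case: pickP => [s /forallP h|/=].
  have [i ->] := perm_act_in hx; rewrite perm_act_ord; exact/eqP/h.
have lt i : (i < n)%N -> ((f i.+1).-1 < n)%N by move=> li; have := fr i.+1; lia.
pose g (i : 'I_n) := Ordinal (lt i (ltn_ord i)).
have ginj : injective g.
  move=> i j [e]; apply/val_inj => /=.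
  have := fr i.+1; have := fr j.+1; have := finj i.+1 j.+1.
  have := ltn_ord i; have := ltn_ord j; lia.
move=> /(_ (perm ginj)) /negbT /forallPn[i]; rewrite permE /=.
by have := fr i.+1; have := ltn_ord i; lia.
Qed.

(** * Reindexing sums and products over integer intervals *)

Section NatBig.
Variables (R : Type) (idx : R) (op : Monoid.com_law idx).

Lemma big_nat_ord n (F : nat -> R) :
  \big[op/idx]_(1 <= i < n.+1) F i = \big[op/idx]_(i < n) F i.+1.
Proof. by rewrite big_add1 /= big_mkord. Qed.

Lemma big_perm_act n (s : 'S_n) (F : nat -> R) :
  \big[op/idx]_(1 <= i < n.+1) F (pa s i) = \big[op/idx]_(1 <= i < n.+1) F i.
Proof.
rewrite !big_nat_ord [RHS](reindex_perm s) /=.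
by apply: eq_bigr => i _; rewrite perm_act_ord.
Qed.

(* Replacing the p-th of k letters by a block of l letters. *)
Lemma big_block k l p (F : nat -> R) : (1 <= p <= k)%N -> (1 <= l)%N ->
  \big[op/idx]_(1 <= x < (k + l - 1).+1) F x =
  \big[op/idx]_(1 <= x < k.+1)
     (if x == p then \big[op/idx]_(1 <= y < l.+1) F (p + y - 1)%N
      else F (if (x < p)%N then x else (x + l - 1)%N)).
Proof.
move=> hp hl; rewrite (@big_cat_nat _ _ _ p) /=; [|lia..].
rewrite (@big_cat_nat _ _ _ (p + l) p) /=; [|lia..].
rewrite [RHS](@big_cat_nat _ _ _ p) /=; [|lia..].
rewrite [in RHS](@big_ltn _ _ _ p); last by lia.
rewrite eqxx; congr (op _ (op _ _)).
- by apply: eq_big_nat => x hx; rewrite ifF; [rewrite ifT //|]; lia.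
- rewrite (_ : p = 1 + (p - 1))%N; last by lia.
  rewrite (_ : 1 + (p - 1) + l = l.+1 + (p - 1))%N; last by lia.
  rewrite big_addn; rewrite (_ : l.+1 + (p - 1) - (p - 1) = l.+1)%N; last by lia.
  by apply: eq_big_nat => y hy; congr F; lia.
- rewrite (_ : p + l = p.+1 + (l - 1))%N; last by lia.
  rewrite big_addn; rewrite (_ : (k + l - 1).+1 - (l - 1) = k.+1)%N; last by lia.
  apply: eq_big_nat => y hy; rewrite ifF; last by lia.
  by rewrite ifF; [congr F|]; lia.
Qed.

End NatBig.

(** * Blowing up one letter of a permutation to a block *)

Definition expand l q x := if (x < q)%N then x else (x + l - 1)%N.

(** Meant for f p = q. The outer cases invert [expand l p]; as f then sends the other letters off q,
    [expand l q] leaves the block at q free for g. *)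
Definition blowup_fun l p q (f g : nat -> nat) x :=
  if (x < p)%N then expand l q (f x)
  else if (x < p + l)%N then (q + g (x - p + 1) - 1)%N
  else expand l q (f (x - l + 1)%N).

Definition blowup n k l p q (s : 'S_k) (t : 'S_l) : 'S_n :=
  perm_of_fun n (blowup_fun l p q (pa s) (pa t)).

Lemma block_cases k l n p x :
  (k + l = n + 1)%N -> (1 <= p <= k)%N -> (1 <= l)%N -> (1 <= x <= n)%N ->
  (exists X, [/\ (1 <= X <= k)%N, X != p & x = expand l p X]) \/
  (exists2 y, (1 <= y <= l)%N & x = (p + y - 1)%N).
Proof.
move=> hn hp hl hx; case: (ltnP x p) => h1.
  by left; exists x; rewrite /expand h1; split; lia.
case: (ltnP x (p + l)) => h2; first by right; exists (x - p + 1)%N; lia.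
by left; exists (x - l + 1)%N; rewrite /expand ifF; [split; lia|lia].
Qed.

Section Blowup.
Variables (n k l p q : nat) (s : 'S_k) (t : 'S_l).
Hypotheses (hn : (k + l = n + 1)%N) (hp : (1 <= p <= k)%N) (hl : (1 <= l)%N).
Hypothesis (sp : pa s p = q).

Let hq : (1 <= q <= k)%N. Proof. by rewrite -sp perm_act_range. Qed.

Let f := blowup_fun l p q (pa s) (pa t).

Let fX X : (1 <= X <= k)%N -> X != p ->
  f (expand l p X) = expand l q (pa s X).
Proof.
move=> hX Xp; rewrite /f /blowup_fun [expand l p X]/expand; case: (ltnP X p) => h.
  by rewrite h.
rewrite !ifF; [|lia..].
by congr (expand _ _ (pa _ _)); lia.
Qed.

Let fy y : (1 <= y <= l)%N -> f (p + y - 1)%N = (q + pa t y - 1)%N.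
Proof.
move=> hy; rewrite /f /blowup_fun ifF; last by lia.
by rewrite ifT; [congr (q + pa t _ - 1)%N|]; lia.
Qed.

Let frange x : (1 <= x <= n)%N -> (1 <= f x <= n)%N.
Proof.
move=> /(block_cases hn hp hl)[[X [hX Xp ->]]|[y hy ->]].
  rewrite fX //; have := perm_act_range s X; rewrite hX /expand.
  by case: ifP; lia.
by rewrite fy //; have := perm_act_range t y; rewrite hy; lia.
Qed.

Let sXq X : X != p -> pa s X != q.
Proof. by apply: contra => /eqP; rewrite -sp => /perm_act_inj->. Qed.

Let finj x y : (1 <= x <= n)%N -> (1 <= y <= n)%N -> f x = f y -> x = y.
Proof.
move=> /(block_cases hn hp hl)[[X [hX Xp ->]]|[a ha ->]];
  move=> /(block_cases hn hp hl)[[Y [hY Yp ->]]|[b hb ->]].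
- rewrite !fX // => e; congr expand; apply: (@perm_act_inj _ s); move: e.
  have := sXq Xp; have := sXq Yp; rewrite /expand; do 2![case: ifP]; lia.
- rewrite fX // fy //; have := perm_act_range t b; have := sXq Xp.
  by rewrite /expand; case: ifP; lia.
- rewrite fX // fy //; have := perm_act_range t a; have := sXq Yp.
  by rewrite /expand; case: ifP; lia.
- rewrite !fy // => e; suff -> : a = b by [].
  apply: (@perm_act_inj _ t); move: e.
  by have := perm_act_range t a; have := perm_act_range t b; lia.
Qed.

Lemma blowup_out X : (1 <= X <= k)%N -> X != p ->
  pa (blowup n p q s t) (expand l p X) = expand l q (pa s X).
Proof.
move=> hX Xp; rewrite -fX //; apply: perm_of_funE => //.
by rewrite /expand; case: ifP; lia.
Qed.

Lemma blowup_in y : (1 <= y <= l)%N ->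
  pa (blowup n p q s t) (p + y - 1)%N = (q + pa t y - 1)%N.
Proof. by move=> hy; rewrite -fy //; apply: perm_of_funE => //; lia. Qed.

End Blowup.

(** * Koszul signs *)

Section Koszul.
Variable K : fieldType.

Local Notation sg z := ((-1 : K) ^ z%R).

Lemma sgD x y : sg (x + y) = sg x * sg y.
Proof. by rewrite expfzDr // oppr_eq0 oner_eq0. Qed.

Lemma sg_sqr x : sg x * sg x = 1.
Proof. by rewrite -expfzMl mulrNN mulr1 exp1rz. Qed.

Lemma sg_sum (I : Type) (r : seq I) (P : pred I) (F : I -> int) :
  sg (\sum_(i <- r | P i) F i) = \prod_(i <- r | P i) sg (F i).
Proof. by apply: (big_morph (fun z => sg z) sgD); rewrite expr0z. Qed.

(* [koszul] for maps of nat, so that permutations of different arities, and the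
   restrictions of one permutation, need no casts. *)
Definition koszul_nat n (f : nat -> nat) (d : nat -> int) : K :=
  \prod_(1 <= i < n.+1) \prod_(1 <= j < n.+1)
     (if (i < j)%N && (f j < f i)%N then sg (d (f i) * d (f j)) else 1).

Lemma koszulE n (s : 'S_n) (d' : 'I_n -> int) (d : nat -> int) :
  (forall i, d' i = d i.+1) -> koszul K s d' = koszul_nat n (pa s) d.
Proof.
move=> dd; rewrite /koszul /koszul_nat big_nat_ord; apply: eq_bigr => i _.
rewrite big_nat_ord [LHS]big_mkcond /=.
by apply: eq_bigr => j _; rewrite !perm_act_ord !dd !ltnS.
Qed.

(** Ordered pairs are folded into pairs x < y because reindexing by a permutation need not preserve
    the order of a pair. *)
Lemma prod_sym n (W : nat -> nat -> K) : (forall x, W x x = 1) ->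
  \prod_(1 <= x < n) \prod_(1 <= y < n) W x y =
  \prod_(1 <= x < n) \prod_(1 <= y < n)
    (if (x < y)%N then W x y * W y x else 1).
Proof.
move=> W1; transitivity (
  (\prod_(1 <= x < n) \prod_(1 <= y < n) (if (x < y)%N then W x y else 1)) *
  (\prod_(1 <= x < n) \prod_(1 <= y < n) (if (y < x)%N then W x y else 1))).
  rewrite -big_split; apply: eq_bigr => x _; rewrite -big_split.
  by apply: eq_bigr => y _ /=; case: ltngtP => [||->]; rewrite ?mulr1 ?mul1r.
rewrite [X in _ * X]exchange_big -big_split; apply: eq_bigr => x _.
rewrite -big_split; apply: eq_bigr => y _ /=.
by case: ltngtP; rewrite ?mulr1.
Qed.

(** Cocycle rule. After reindexing the sign of [s] by [t], both sides are products over pairs x < y;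
    a pair inverted by [t] and inverted back by [s] contributes the same sign twice, which
    cancels. *)
Lemma koszul_natM n (s t : 'S_n) d :
  koszul_nat n (pa (t * s)%g) d =
  koszul_nat n (pa s) d * koszul_nat n (pa t) (d \o pa s).
Proof.
rewrite /koszul_nat -[X in _ = X * _](big_perm_act _ t) /=.
rewrite [X in _ = X * _](eq_bigr (fun x => \prod_(1 <= y < n.+1)
  (if (pa t x < pa t y)%N && (pa s (pa t y) < pa s (pa t x))%N
   then sg (d (pa s (pa t x)) * d (pa s (pa t y))) else 1))); last first.
  by move=> x _; rewrite -[LHS](big_perm_act _ t).
rewrite [X in _ = X * _]prod_sym; last by move=> x; rewrite ltnn.
rewrite -big_split; apply: eq_bigr => x _; rewrite -big_split.
apply: eq_bigr => y _ /=; rewrite !perm_actM.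
have [xy|] := ltnP x y; last by rewrite mulr1.
case: (ltngtP (pa t x) (pa t y)) => [h|h|/perm_act_inj e]; last by lia.
  by rewrite /= !mulr1.
rewrite /= mul1r; case: (ltngtP (pa s (pa t x)) (pa s (pa t y))) => h'.
- by rewrite mulrC [X in sg X * _]mulrC sg_sqr.
- by rewrite mul1r.
- by move/perm_act_inj/perm_act_inj: h'; lia.
Qed.

Lemma koszul_nat_stable n f d :
  f n.+1 = n.+1 -> (forall x, (1 <= x <= n)%N -> (f x <= n)%N) ->
  koszul_nat n.+1 f d = koszul_nat n f d.
Proof.
move=> fn fx; rewrite /koszul_nat big_nat_recr //= [X in _ * X]big1_seq ?mulr1.
  apply: eq_big_nat => i hi; rewrite big_nat_recr //= ifF ?mulr1 //.
  by have := fx i; rewrite fn; lia.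
by move=> i /andP[_]; rewrite mem_index_iota => hi; rewrite ifF //; lia.
Qed.

(** Degrees of the arguments once the block at q is replaced by the value of an operation on it; the
    summand 1 is the degree of that operation. *)
Definition block_degree l q (d : nat -> int) j : int :=
  if j == q then 1 + \sum_(1 <= t < l.+1) d (q + t - 1)%N else d (expand l q j).

Lemma big_block2 k l p (W : nat -> nat -> K) : (1 <= p <= k)%N -> (1 <= l)%N ->
  \prod_(1 <= x < (k + l - 1).+1) \prod_(1 <= y < (k + l - 1).+1) W x y =
  \prod_(1 <= X < k.+1) \prod_(1 <= Y < k.+1)
    (if X == p then
       if Y == p then \prod_(1 <= x < l.+1) \prod_(1 <= y < l.+1)
         W (p + x - 1)%N (p + y - 1)%N
       else \prod_(1 <= x < l.+1) W (p + x - 1)%N (expand l p Y)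
     else if Y == p then \prod_(1 <= y < l.+1) W (expand l p X) (p + y - 1)%N
       else W (expand l p X) (expand l p Y)).
Proof.
move=> hp hl; rewrite (big_block _ _ hp hl); apply: eq_bigr => X _.
case: eqP => Xp; last first.
  by rewrite (big_block _ _ hp hl); apply: eq_bigr => Y _.
under eq_bigr => x _ do rewrite (big_block _ _ hp hl).
rewrite exchange_big /=; apply: eq_bigr => Y _; by case: eqP.
Qed.

(* Both sides move the two operations, which have degree one, past the letters
   in front of them. *)
Lemma koszul_blowup n k l p q (s : 'S_k) (t : 'S_l) d :
  (k + l = n + 1)%N -> (1 <= p <= k)%N -> (1 <= l)%N -> pa s p = q ->
  sg (\sum_(1 <= x < q) d x) * koszul_nat k (pa s) (block_degree l q d)
    * koszul_nat l (pa t) (fun y => d (q + y - 1)%N) =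
  koszul_nat n (pa (blowup n p q s t)) d
    * sg (\sum_(1 <= x < p) d (pa (blowup n p q s t) x)).
Proof.
move=> hn hp hl sp; have hq : (1 <= q <= k)%N by rewrite -sp perm_act_range.
set b := blowup _ _ _ _ _.
have bX X : (1 <= X <= k)%N -> X != p -> pa b (expand l p X) = expand l q (pa s X).
  by move=> *; apply: blowup_out.
have by_ y : (1 <= y <= l)%N -> pa b (p + y - 1)%N = (q + pa t y - 1)%N.
  by move=> *; apply: blowup_in.
have sXq X : X != p -> pa s X != q.
  by apply: contra => /eqP; rewrite -sp => /perm_act_inj->.
(* [S] omits the operation's own degree: with [dq] the Koszul sign of the blowup factors exactly,
   since a block crosses a letter with the sum of its degrees. *)
pose S := \sum_(1 <= y < l.+1) d (q + y - 1)%N.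
pose dq j : int := if j == q then S else d (expand l q j).
have kb : koszul_nat n (pa b) d =
    koszul_nat k (pa s) dq * koszul_nat l (pa t) (fun y => d (q + y - 1)%N).
  rewrite [LHS]/koszul_nat (_ : n.+1 = (k + l - 1).+1)%N; last by lia.
  rewrite (big_block2 _ hp hl).
  transitivity (koszul_nat k (pa s) dq * (\prod_(1 <= X < k.+1)
     (if X == p then \prod_(1 <= Y < k.+1) (if Y == p then
        koszul_nat l (pa t) (fun y => d (q + y - 1)%N) else 1) else 1))); last first.
    by congr (_ * _); rewrite -big_mkcond big_nat1_eq ifT -?big_mkcond
      ?big_nat1_eq ?ifT //; lia.
  rewrite -big_split; apply: eq_big_nat => X hX /=.
  case: (eqVneq X p) => [->|Xp]; rewrite ?mulr1 -?big_split /=;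
    apply: eq_big_nat => Y hY; case: (eqVneq Y p) => [->|Yp].
  - rewrite ltnn mul1r; apply: eq_big_nat => x hx; apply: eq_big_nat => y hy.
    rewrite !by_ //.
    have := perm_act_range t x; have := perm_act_range t y; rewrite hx hy => h1 h2.
    by congr (if _ then _ else _); lia.
  - rewrite mulr1 sp; have sYq := sXq _ Yp; rewrite /dq eqxx (negPf sYq).
    under eq_big_nat => x hx do rewrite by_ // bX //.
    have eC x : (1 <= x < l.+1)%N ->
      ((p + x - 1 < expand l p Y)%N && (expand l q (pa s Y) < q + pa t x - 1)%N)
      = ((p < Y)%N && (pa s Y < q)%N).
      move=> hx; have := perm_act_range t x; rewrite hx => h1.
      by rewrite /expand; do 2!case: ifP; lia.
    under eq_big_nat => x hx do rewrite (eC _ hx).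
    case: ifP => _; last by rewrite big1_eq.
    rewrite -sg_sum -mulr_suml; congr (sg (_ * _)).
    exact: (big_perm_act _ t (fun y => d (q + y - 1)%N)).
  - rewrite sp; have sYq := sXq _ Xp; rewrite /dq eqxx (negPf sYq).
    under eq_big_nat => x hx do rewrite by_ // bX //.
    have eC x : (1 <= x < l.+1)%N ->
      ((expand l p X < p + x - 1)%N && (q + pa t x - 1 < expand l q (pa s X))%N)
      = ((X < p)%N && (q < pa s X)%N).
      move=> hx; have := perm_act_range t x; rewrite hx => h1.
      by rewrite /expand; do 2!case: ifP; lia.
    under eq_big_nat => x hx do rewrite (eC _ hx).
    case: ifP => _; last by rewrite big1_eq.
    rewrite -sg_sum -mulr_sumr; congr (sg (_ * _)).
    exact: (big_perm_act _ t (fun y => d (q + y - 1)%N)).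
  - rewrite !bX // /dq (negPf (sXq _ Xp)) (negPf (sXq _ Yp)).
    have := sXq _ Xp; have := sXq _ Yp => h1 h2.
    by congr (if _ then _ else _); rewrite /expand; do 4!case: ifP; lia.
(* Signs due to the extra 1: [g1] from letters that move from behind the slot to its front, [g2]
   from those that go the other way. *)
pose g1 Y :=
  if (p < Y)%N && (pa s Y < q)%N then sg (block_degree l q d (pa s Y)) else 1.
pose g2 X :=
  if (X < p)%N && (q < pa s X)%N then sg (block_degree l q d (pa s X)) else 1.
have ks : koszul_nat k (pa s) (block_degree l q d) = koszul_nat k (pa s) dq *
    (\prod_(1 <= X < k.+1) g1 X * \prod_(1 <= X < k.+1) g2 X).
  transitivity (koszul_nat k (pa s) dq *
    ((\prod_(1 <= X < k.+1) (if X == p then \prod_(1 <= Y < k.+1) g1 Y else 1)) *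
     \prod_(1 <= X < k.+1) (\prod_(1 <= Y < k.+1) if Y == p then g2 X else 1))).
    rewrite -!big_split; apply: eq_big_nat => X hX /=.
    case: (eqVneq X p) => [->|Xp]; rewrite ?mul1r -!big_split /=;
      apply: eq_big_nat => Y hY; case: (eqVneq Y p) => [->|Yp].
    - rewrite /g1 /g2 !ltnn /= ?mulr1 ?mul1r; done.
    - rewrite sp /g1 mulr1; case: ifP; rewrite ?mulr1 // => _.
      rewrite /dq eqxx (negPf (sXq _ Yp)) /block_degree eqxx (negPf (sXq _ Yp)).
      by rewrite mulrDl mul1r sgD mulrC.
    - rewrite sp /g2; case: ifP; rewrite ?mulr1 // => _.
      rewrite /dq eqxx (negPf (sXq _ Xp)) /block_degree eqxx (negPf (sXq _ Xp)).
      by rewrite mulrDr mulr1 sgD mulrC.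
    - rewrite mulr1 /dq /block_degree.
      by rewrite (negPf (sXq _ Xp)) (negPf (sXq _ Yp)).
  congr (_ * (_ * _)); first by rewrite -big_mkcond big_nat1_eq ifT //; lia.
  apply: eq_big_nat => X hX; rewrite -big_mkcond big_nat1_eq ifT //; lia.
have sq : sg (\sum_(1 <= x < q) d x) = \prod_(1 <= X < k.+1)
    (if (pa s X < q)%N then sg (block_degree l q d (pa s X)) else 1).
  rewrite (big_perm_act _ s
    (fun x => if (x < q)%N then sg (block_degree l q d x) else 1)) sg_sum.
  rewrite (@big_nat_widen _ _ _ 1 q k.+1) ?big_mkcond /=; last by lia.
  apply: eq_big_nat => x hx; case: ifP => // xq.
  by rewrite /block_degree ifF /expand ?xq //; lia.
have sp' : sg (\sum_(1 <= x < p) d (pa b x)) = \prod_(1 <= X < k.+1)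
    (if (X < p)%N then sg (block_degree l q d (pa s X)) else 1).
  rewrite sg_sum (@big_nat_widen _ _ _ 1 p k.+1) ?big_mkcond /=; last by lia.
  apply: eq_big_nat => x hx; case: ifP => // xp.
  have xnp : x != p by lia.
  rewrite /block_degree (negPf (sXq _ xnp)) -bX ?/expand ?xp //; lia.
(* Letter by letter: being in front of p and being sent in front of q differ exactly when the letter
   is inverted with the slot. *)
suff e : sg (\sum_(1 <= x < q) d x) *
    (\prod_(1 <= X < k.+1) g1 X * \prod_(1 <= X < k.+1) g2 X) =
    sg (\sum_(1 <= x < p) d (pa b x)) by rewrite ks kb -e; ring.
rewrite sq sp' -!big_split /=.
apply: eq_big_nat => X hX; rewrite /g1 /g2.
case: (eqVneq X p) => [->|Xp]; first by rewrite sp !ltnn /= !mulr1.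
have := sXq _ Xp; case: (ltngtP (pa s X) q) => // _ _.
  by case: ltngtP Xp => // _ _; rewrite /= ?mulr1 ?mul1r ?sg_sqr.
by case: ltngtP Xp => // _ _; rewrite /= ?mulr1 ?mul1r ?sg_sqr.
Qed.

End Koszul.

(** * Shuffles and Young subgroups *)

Section Young.
Variables (n : nat) (T : eqType) (blk : 'I_n -> T).

(** Blocks are the fibres of [blk], which need not be intervals: outer letters can lie on both sides
    of an inserted block. *)
Definition young : {set 'S_n} := [set y : 'S_n | [forall i, blk (y i) == blk i]].

Definition block_shuffle (s : 'S_n) : bool :=
  [forall x : 'I_n, forall y : 'I_n, (x < y)%N && (blk x == blk y) ==> (s x < s y)%N].

Lemma youngP (y : 'S_n) : reflect (forall i, blk (y i) = blk i) (y \in young).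
Proof.
by rewrite inE; apply: (iffP forallP) => h i; [exact/eqP/h | apply/eqP/h].
Qed.

Lemma young_group_set : group_set young.
Proof.
apply/group_setP; split; first by apply/youngP => i; rewrite perm1.
move=> x y /youngP hx /youngP hy; apply/youngP => i.
by rewrite permM hy hx.
Qed.
Canonical young_group := Group young_group_set.

(** The smallest point x moved by y satisfies x < y x and x < y^-1 x, all in one block. Increase of
    s gives s x < s (y x), while increase of y * s at x and y^-1 x gives the reverse. *)
Lemma block_shuffle_uniq (y s : 'S_n) : y \in young ->
  block_shuffle s -> block_shuffle (y * s)%g -> y = 1%g.
Proof.
move=> yY ss sys; apply/eqP/negPn/negP => y1.
have [x0 hx0] : exists x, y x != x.
  apply/existsP; apply: contraNT y1 => /existsPn h; apply/eqP/permP => i.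
  by rewrite perm1; apply/eqP/negPn/h.
case: (@arg_minnP _ x0 (fun x => y x != x) (@nat_of_ord n) hx0) => x yx xmin.
have lt1 : (x < y x)%N.
  rewrite ltn_neqAle eq_sym; rewrite (inj_eq val_inj) yx /= leqNgt.
  apply/negP => h; have := contraNN (xmin (y x)); rewrite -ltnNge => /(_ h).
  by move/negPn/eqP/perm_inj => e; rewrite e eqxx in yx.
have := sys => /forallP/(_ x)/forallP/(_ (y^-1%g x)); rewrite !permM permKV.
have yV : y^-1%g x != x by apply: contraNneq yx => e; rewrite -{1}e permKV.
have lt2 : (x < y^-1%g x)%N.
  rewrite ltn_neqAle eq_sym; rewrite (inj_eq val_inj) yV /=.
  by apply: xmin; rewrite permKV eq_sym.
have /youngP bV := groupVr yY; have /youngP b := yY.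
rewrite lt2 bV eqxx /= => h.
have := ss => /forallP/(_ x)/forallP/(_ (y x)); rewrite lt1 b eqxx /=.
by move: h; lia.
Qed.

(* Among the rearrangements of [s] by [young], the one maximising
   [\sum_i i * s i] is increasing on blocks, by the rearrangement inequality. *)
Lemma block_shuffle_ex (s : 'S_n) : exists2 y, y \in young & block_shuffle (y * s)%g.
Proof.
pose M (y : 'S_n) := (\sum_(i < n) i * (y * s)%g i)%N.
case: (@arg_maxnP _ 1%g (mem young) M (group1 _)) => y yY ymax.
exists y => //; apply/forallP => a; apply/forallP => b; apply/implyP.
case/andP => ab /eqP eab; rewrite ltnNge; apply/negP => hs.
have anb : b != a by rewrite -(inj_eq val_inj) /=; lia.
have hs' : ((y * s)%g b < (y * s)%g a)%N.
  by rewrite ltn_neqAle hs andbT (inj_eq val_inj) (inj_eq perm_inj).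
have tY : (tperm a b \in young).
  by apply/youngP => i; case: tpermP => [->|->|].
have := ymax _ (groupM tY yY); apply/negP; rewrite -ltnNge /M.
rewrite -mulgA; move: (y * s)%g hs' {hs ymax} => u hs'.
rewrite (bigD1 a) //= (bigD1 b) //= [ltnRHS](bigD1 a) //= [in ltnRHS](bigD1 b) //=.
rewrite !permM tpermL tpermR [in ltnRHS](eq_bigr (fun i : 'I_n => i * u i)%N).
  by rewrite !addnA ltn_add2r; nia.
by move=> i /andP[h1 h2]; rewrite permM tpermD // eq_sym.
Qed.

(** Each right coset of [young] contains exactly one block shuffle, by existence and uniqueness
    above, and [G] is constant on it. *)
Lemma sum_block_shuffle (V : nmodType) (G : 'S_n -> V) :
  (forall y s, y \in young -> G (y * s)%g = G s) ->
  \sum_s G s = (\sum_(s | block_shuffle s) G s) *+ #|young|.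
Proof.
move=> GY.
pose r s := odflt 1%g [pick u | (u \in (young :* s)%g) && block_shuffle u].
have rP s : (r s \in (young :* s)%g) /\ block_shuffle (r s).
  rewrite /r; case: pickP => [u /andP[]//|/=].
  have [y yY sy] := block_shuffle_ex s.
  by move/(_ (y * s)%g); rewrite sy andbT mem_rcoset mulgK yY.
have rE s u : block_shuffle u -> (r s == u) = (s \in (young :* u)%g).
  move=> su; have [rs sr] := rP s; apply/eqP/idP => [<-|h].
    by rewrite mem_rcoset -groupV invMg invgK -mem_rcoset.
  have yY : (r s * u^-1)%g \in young.
    by rewrite -mem_rcoset; rewrite (rcoset_eqP h) in rs.
  have := block_shuffle_uniq yY su; rewrite mulgKV => /(_ sr) e.
  by rewrite -[LHS](mulgKV u) e mul1g.
rewrite (partition_big r block_shuffle) /=; last by move=> s _; case: (rP s).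
rewrite -sumrMnl; apply: eq_bigr => u su.
rewrite (eq_bigl (mem (young :* u)%g)) => [|s]; last by rewrite rE.
rewrite (eq_bigr (fun=> G u)) ?sumr_const ?card_rcoset // => s.
by case/rcosetP => y yY ->; rewrite GY.
Qed.

End Young.

(** * Counting permutations with prescribed values *)

Definition fix2 k q : {set 'S_k} :=
  [set s : 'S_k | (pa s q == q) && (pa s k == k)].

Lemma fix2P k q (s : 'S_k) : reflect (pa s q = q /\ pa s k = k) (s \in fix2 k q).
Proof. by rewrite inE; apply: (iffP andP) => -[/eqP-> /eqP->]. Qed.

Lemma tperm_act k (i j : 'I_k) x : pa (tperm i j) x =
  if x == i.+1 then j.+1 else if x == j.+1 then i.+1 else x.
Proof.
have [/perm_act_in[a ->]|] := boolP (1 <= x <= k)%N.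
  rewrite perm_act_ord; case: tpermP => [->|->|ai aj].
  - by rewrite eqxx.
  - by case: eqP => [->//|_]; rewrite eqxx.
  - rewrite ifF; last by apply/eqP => -[/val_inj].
    by rewrite ifF //; apply/eqP => -[/val_inj].
have := ltn_ord i; have := ltn_ord j; case: x => // x li lj h.
by rewrite perm_act_out 1?[RHS]ifF 1?[RHS]ifF //; lia.
Qed.

(** The set is a coset of [fix2 k q]; the last hypothesis makes the two prescribed values compatible
    with injectivity. *)
Lemma card_perm_act2 k q p m : (1 <= q <= k)%N -> (1 <= p <= k)%N ->
  (1 <= m <= k)%N -> (p == m) = (q == k) ->
  #|[set s : 'S_k | (pa s p == q) && (pa s m == k)]| = #|fix2 k q|.
Proof.
move=> hq hp hm e; have [qi eq] := perm_act_in hq.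
have [pi ep] := perm_act_in hp.
have h1 : (1 <= pa (tperm pi qi) m <= k)%N by rewrite perm_act_range.
have [mi em] := perm_act_in h1.
have [ki ek] : exists i : 'I_k, k = i.+1 by apply: perm_act_in; lia.
(* The first transposition sends p to q, the second sends the image of m to k and, by compatibility,
   keeps q in place. *)
pose s0 := (tperm pi qi * tperm mi ki)%g.
have tpp : pa (tperm pi qi) p = q by rewrite tperm_act -ep eqxx -eq.
have s0p : pa s0 p = q.
  have pmq : (q == pa (tperm pi qi) m) = (q == k).
    by rewrite -e -{1}tpp (inj_eq (@perm_act_inj _ _)).
  by rewrite perm_actM tpp tperm_act -em -ek pmq; case: eqP => [->|_].
have s0m : pa s0 m = k by rewrite perm_actM tperm_act -em eqxx -ek.
have s0q : pa s0^-1%g q = p by rewrite -s0p perm_actK.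
have s0k : pa s0^-1%g k = m by apply: (@perm_act_inj _ s0); rewrite perm_actKV.
rewrite -(card_lcoset (fix2 k q) s0); apply: eq_card => s.
by rewrite mem_lcoset !inE !perm_actM s0q s0k.
Qed.

(** Sorting by the preimages p of q and m of k: every admissible pair comes from equally many
    permutations. *)
Lemma sum_perm_act2 (V : nmodType) k q (F : nat -> nat -> V) :
  (1 <= q <= k)%N ->
  \sum_(s : 'S_k) F (pa s^-1%g q) (pa s^-1%g k) =
  (\sum_(1 <= p < k.+1) \sum_(1 <= m < k.+1 | (p == m) == (q == k)) F p m)
    *+ #|fix2 k q|.
Proof.
move=> hq; have hk : (1 <= k <= k)%N by lia.
rewrite -sumrMnl.
transitivity (\sum_(s : 'S_k) \sum_(1 <= p < k.+1) \sum_(1 <= m < k.+1)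
   (if (pa s p == q) && (pa s m == k) then F p m else 0)).
  apply: eq_bigr => s _.
  have r1 : (1 <= pa s^-1%g q <= k)%N by rewrite perm_act_range.
  have r2 : (1 <= pa s^-1%g k <= k)%N by rewrite perm_act_range.
  rewrite (eq_bigr (fun p => if p == pa s^-1%g q then F p (pa s^-1%g k) else 0)).
    by rewrite -big_mkcond big_nat1_eq ifT //; lia.
  move=> p _; rewrite perm_act_eqV; case: eqP => _ /=; last by rewrite big1_eq.
  rewrite -big_mkcond (eq_bigl (pred1 (pa s^-1%g k))).
    by rewrite big_nat1_eq ifT //; lia.
  by move=> m; rewrite perm_act_eqV.
rewrite exchange_big; apply: eq_big_nat => p hp /=.
rewrite exchange_big -sumrMnl [RHS]big_mkcond; apply: eq_big_nat => m hm /=.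
rewrite -big_mkcond sumr_const; case: eqP => e.
  congr (_ *+ _); rewrite -(card_perm_act2 hq hp hm e).
  by apply: eq_card => s; rewrite !inE.
rewrite (_ : #|_| = 0%N) //; apply: eq_card0 => s; rewrite !inE.
apply/negP => /andP[/eqP h1 /eqP h2]; apply: e; rewrite -h1 -{2}h2.
by rewrite (inj_eq (@perm_act_inj _ s)).
Qed.

Lemma sum_perm_act1 (V : nmodType) k (F : nat -> V) : (1 <= k)%N ->
  \sum_(s : 'S_k) F (pa s^-1%g k) = (\sum_(1 <= p < k.+1) F p) *+ #|fix2 k k|.
Proof.
move=> hk; rewrite (@sum_perm_act2 _ k k (fun=> F)) ?hk ?leqnn //.
congr (_ *+ _); apply: eq_big_nat => p hp; rewrite eqxx.
rewrite (eq_bigl (pred1 p)) => [|m]; last by rewrite eqb_id eq_sym.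
by rewrite big_nat1_eq ifT //; lia.
Qed.

Lemma perm_act_fixE m (s : 'S_m) q x : pa s q = q -> (pa s x == q) = (x == q).
Proof. by move=> sq; rewrite perm_act_eqV -[in pa _ q]sq perm_actK. Qed.

(* Outer letters, inner letters, the last inner letter and the last letter:
   for q = k and q = 1 these are the blocks of the two kinds of shuffles in the
   pre-Lie identity, together with {n}. *)
Definition block_label n l q x : bool * bool * bool :=
  ((q <= x < q + l)%N, x == (q + l - 1)%N, x == n).

(** * The Young subgroup of an insertion as a set of blowups *)

Section YoungBlowup.
Variables (n k l q : nat).
Hypotheses (hn : (k + l = n + 1)%N) (hq : (1 <= q <= k)%N) (hl : (1 <= l)%N).

Local Notation Y := (young (fun i : 'I_n => block_label n l q i.+1)).

Let YP (y : 'S_n) :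
  reflect (forall x, (1 <= x <= n)%N -> block_label n l q (pa y x) = block_label n l q x)
    (y \in Y).
Proof.
apply: (iffP (youngP _ _)) => h i.
  by move=> /perm_act_in[j ->]; rewrite perm_act_ord h.
by have := h i.+1; rewrite perm_act_ord => -> //; rewrite /= ltn_ord.
Qed.

Lemma blowup_young (s : 'S_k) (t : 'S_l) :
  s \in fix2 k q -> t \in fix2 l l -> blowup n q q s t \in Y.
Proof.
move=> /fix2P[sq sk] /fix2P[tl _]; apply/YP => x.
case/(block_cases hn hq hl) => [[X [hX Xq ->]]|[y hy ->]].
  rewrite blowup_out //; have := perm_act_range s X; rewrite hX => r.
  have sXq : pa s X != q by rewrite perm_act_fixE.
  have e : (pa s X == k) = (X == k).
    by rewrite perm_act_fixE.
  by rewrite /block_label /expand; congr (_, _, _); do 2!case: ifP; lia.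
rewrite blowup_in //; have := perm_act_range t y; rewrite hy => r.
have e : (pa t y == l) = (y == l) by rewrite perm_act_fixE.
by rewrite /block_label; congr (_, _, _); lia.
Qed.

Lemma blowup_inj (s s' : 'S_k) (t t' : 'S_l) :
  s \in fix2 k q -> s' \in fix2 k q ->
  blowup n q q s t = blowup n q q s' t' -> s = s' /\ t = t'.
Proof.
move=> /fix2P[sq sk] /fix2P[sq' sk'] e; split; apply: perm_act_eq => x hx.
  have [->|xq] := eqVneq x q; first by rewrite sq sq'.
  have := congr1 (fun u => pa u (expand l q x)) e.
  rewrite !blowup_out //.
  have h1 : pa s x != q by rewrite perm_act_fixE.
  have h2 : pa s' x != q by rewrite perm_act_fixE.
  by rewrite /expand; do 2!case: ifP; lia.
have := congr1 (fun u => pa u (q + x - 1)%N) e.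
rewrite !blowup_in //.
by have := perm_act_range t x; have := perm_act_range t' x; rewrite hx; lia.
Qed.

(** [y] preserves the set of inner letters, so it induces [f] on the slots, the block being
    contracted to slot q, and [g] inside the block. *)
Lemma young_blowup (y : 'S_n) : y \in Y ->
  exists s : 'S_k, exists t : 'S_l,
    [/\ s \in fix2 k q, t \in fix2 l l & y = blowup n q q s t].
Proof.
move=> /YP h.
have blkE a b : block_label n l q a = block_label n l q b ->
    [/\ (q <= a < q + l)%N = (q <= b < q + l)%N,
        (a == (q + l - 1)%N) = (b == (q + l - 1)%N) & (a == n) = (b == n)].
  by case=> -> -> ->.
pose f X := if X == q then q else
  let z := pa y (expand l q X) in if (z < q)%N then z else (z - l + 1)%N.
pose g a := (pa y (q + a - 1) - q + 1)%N.
have fP X : (1 <= X <= k)%N -> X != q ->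
    [/\ (1 <= f X <= k)%N, f X != q & expand l q (f X) = pa y (expand l q X)].
  move=> hX Xq; have he : (1 <= expand l q X <= n)%N.
    by rewrite /expand; case: ifP; lia.
  have hi : (q <= expand l q X < q + l)%N = false.
    by rewrite /expand; case: ifP; lia.
  have := perm_act_range y (expand l q X); rewrite he.
  have /blkE[] := h _ he; rewrite hi /f (negPf Xq) /=.
  set z := pa y _ => h1 h2 h3 h4; rewrite {1}/expand.
  by case: (ltnP z q) => h5; [rewrite h5 | have -> : (z - l + 1 < q)%N = false by lia];
    split; lia.
have gP a : (1 <= a <= l)%N ->
    (1 <= g a <= l)%N /\ (q + g a - 1)%N = pa y (q + a - 1)%N.
  move=> ha; have he : (1 <= q + a - 1 <= n)%N by lia.
  have hi : (q <= q + a - 1 < q + l)%N = true by lia.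
  have := perm_act_range y (q + a - 1); rewrite he.
  by have /blkE[] := h _ he; rewrite hi /g => h1 h2 h3 h4; split; lia.
have fq : f q = q by rewrite /f eqxx.
have sE : forall X, (1 <= X <= k)%N -> pa (perm_of_fun k f) X = f X.
  apply: perm_of_funE => [X hX|X X' hX hX'].
    by have [->|/(fP _ hX)[]//] := eqVneq X q; rewrite fq.
  have [->|Xq] := eqVneq X q.
    by have [->//|/(fP _ hX')[_]] := eqVneq X' q; rewrite fq; lia.
  have [->|X'q] := eqVneq X' q; first by have [_] := fP _ hX Xq; rewrite fq; lia.
  have [_ _ e1] := fP _ hX Xq; have [_ _ e2] := fP _ hX' X'q => e.
  have : expand l q X = expand l q X' by apply: (@perm_act_inj _ y); rewrite -e1 e.
  by rewrite /expand; do 2!case: ifP; lia.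
have tE : forall a, (1 <= a <= l)%N -> pa (perm_of_fun l g) a = g a.
  apply: perm_of_funE => [a /gP[]//|a b ha hb e].
  have [_ e1] := gP _ ha; have [_ e2] := gP _ hb.
  have : (q + a - 1 = q + b - 1)%N by apply: (@perm_act_inj _ y); rewrite -e1 e.
  by lia.
(* [f] fixes k: by definition if k = q, and otherwise because slot k carries the letter n, which is
   alone in its block. *)
have sfix : perm_of_fun k f \in fix2 k q.
  apply/fix2P; rewrite !sE ?fq //; [split=> //|lia].
  have [->|kq] := eqVneq k q; first by rewrite fq.
  have hk : (1 <= k <= k)%N by lia.
  have [h1 h2] := fP _ hk kq.
  have ek : expand l q k = n by rewrite /expand ifF; lia.
  have /blkE[_ _] := h n ltac:(lia); rewrite eqxx ek => /eqP->.
  by rewrite /expand; case: ifP; lia.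
exists (perm_of_fun k f), (perm_of_fun l g); split=> //.
  apply/fix2P; rewrite tE ?leqnn ?hl //.
  have [h1 h2] := gP l ltac:(lia).
  have /blkE[_ + _] := h (q + l - 1)%N ltac:(lia); rewrite eqxx -h2; lia.
have sq : pa (perm_of_fun k f) q = q by rewrite sE.
apply: perm_act_eq => x /(block_cases hn hq hl)[[X [hX Xq ->]]|[a ha ->]].
  by rewrite blowup_out // sE //; have [] := fP _ hX Xq.
by rewrite blowup_in // tE //; have [] := gP _ ha.
Qed.

Lemma card_young_blowup : #|Y| = (#|fix2 k q| * #|fix2 l l|)%N.
Proof.
rewrite -cardsX.
rewrite -(@card_in_imset _ _ (fun u : 'S_k * 'S_l => blowup n q q u.1 u.2)).
  apply: eq_card => y; apply/idP/imsetP => [/young_blowup[s [t [hs ht ->]]]|].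
    by exists (s, t); rewrite // !inE /=; move: hs ht; rewrite !inE => -> ->.
  by case=> -[s t] /setXP[hs ht] ->; apply: blowup_young.
move=> [s t] [s' t'] /setXP[/= hs ht] /setXP[/= hs' ht'] e.
by have [-> ->] := blowup_inj hs hs' e.
Qed.

End YoungBlowup.

(** * Shuffles of n letters inside the symmetric group on n + 1 letters *)

Lemma perm_of_fun_up m n (s : 'S_m) : (m <= n)%N ->
  pa (perm_of_fun n (pa s)) = pa s.
Proof.
move=> mn; apply/funext => x.
have r z : (1 <= z <= n)%N -> (1 <= pa s z <= n)%N.
  move=> hz; case: (ltnP m z) => h; first by rewrite perm_act_out.
  have hz' : (1 <= z <= m)%N by lia.
  by have := perm_act_range s z; rewrite hz'; lia.
case: (ltnP n x) => h.
  by rewrite !perm_act_out //; apply: leq_ltn_trans h.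
case: x h => // x h; apply: perm_of_funE => //.
by move=> a b _ _ /perm_act_inj.
Qed.

Lemma perm_of_fun_down n (s : 'S_n.+1) : pa s n.+1 = n.+1 ->
  pa (perm_of_fun n (pa s)) = pa s.
Proof.
move=> sn; apply/funext => x.
have r z : (1 <= z <= n)%N -> (1 <= pa s z <= n)%N.
  move=> hz; have := perm_act_range s z.
  by have := inj_eq (@perm_act_inj _ s) z n.+1; rewrite sn; lia.
case: (ltnP n x) => h.
  rewrite perm_act_out //; case: (ltnP n.+1 x) => h'; first by rewrite perm_act_out.
  by have -> : x = n.+1 by lia.
case: x h => // x h; apply: perm_of_funE => //.
by move=> a b _ _ /perm_act_inj.
Qed.

(** [F] sees a permutation only through its action on integers, which is the same in both groups. As
    n + 1 is alone in its block, it adds no condition of increase. *)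
Lemma sum_shuffle_lift (V : nmodType) (T : eqType) n (c : seq nat)
    (blk : nat -> T) (F : (nat -> nat) -> V) :
  (forall x y, (x < n)%N -> (y < n)%N ->
     (reshape_index c x == reshape_index c y) = (blk x.+1 == blk y.+1)) ->
  (forall x, (1 <= x <= n)%N -> blk x != blk n.+1) ->
  \sum_(s : 'S_n | shuffle c s) F (pa s) =
  \sum_(s : 'S_n.+1 | block_shuffle (fun i : 'I_n.+1 => blk i.+1) s
                      && (pa s n.+1 == n.+1)) F (pa s).
Proof.
move=> hc hb.
rewrite [RHS](reindex_onto (fun s : 'S_n => perm_of_fun n.+1 (pa s))
  (fun s : 'S_n.+1 => perm_of_fun n (pa s))) /=; last first.
  move=> s /andP[_ /eqP sn]; apply: perm_act_eq => x _.
  by rewrite perm_of_fun_up // perm_of_fun_down.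
apply: eq_big => [s|s _]; last by rewrite perm_of_fun_up.
set u := perm_of_fun n.+1 (pa s).
have ue : pa u = pa s by rewrite perm_of_fun_up.
have un : pa u n.+1 = n.+1 by rewrite ue perm_act_out.
have -> : perm_of_fun n (pa u) = s.
  by apply: perm_act_eq => x _; rewrite (perm_of_fun_down un) ue.
have uE (i : 'I_n.+1) : (u i).+1 = pa s i.+1 by rewrite -ue perm_act_ord.
have sE (i : 'I_n) : (s i).+1 = pa s i.+1 by rewrite perm_act_ord.
rewrite un !eqxx !andbT; apply/idP/idP.
  move=> /forallP h; apply/forallP => x; apply/forallP => y; apply/implyP.
  case/andP=> xy /eqP exy.
  have yn : (y < n)%N.
    have := ltn_ord y; rewrite ltnS leq_eqVlt => /orP[/eqP yn|//].
    by have := hb x.+1; rewrite exy yn eqxx => /(_ ltac:(lia)).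
  have xn : (x < n)%N by lia.
  have /forallP/(_ (Ordinal yn)) := h (Ordinal xn); rewrite /= xy hc // exy eqxx.
  have := uE x; have := uE y.
  by rewrite -(sE (Ordinal xn)) -(sE (Ordinal yn)) => -[->] [->].
move=> /forallP h; apply/forallP => x; apply/forallP => y; apply/implyP.
case/andP=> xy exy; have xn := ltn_ord x; have yn := ltn_ord y.
have /forallP/(_ (widen_ord (leqnSn n) y)) := h (widen_ord (leqnSn n) x).
rewrite /= xy -hc // exy /=.
have := uE (widen_ord (leqnSn n) x); have := uE (widen_ord (leqnSn n) y).
by rewrite -(sE x) -(sE y) => -[->] [->].
Qed.

(** * Multilinear operations *)

Section Graded.
Variables (K : fieldType) (D : gradedSpace K).

Lemma homogD d (x y : D) : homog d x -> homog d y -> homog d (x + y).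
Proof. by rewrite /homog linearD => -> ->. Qed.

Lemma homogZ d c (x : D) : homog d x -> homog d (c *: x).
Proof. by rewrite /homog linearZ /= => ->. Qed.

Lemma homog_sum d (I : Type) (r : seq I) (P : pred I) (F : I -> D) :
  (forall i, P i -> homog d (F i)) -> homog d (\sum_(i <- r | P i) F i).
Proof.
by apply: big_ind; [rewrite /homog linear0 | exact: homogD].
Qed.

Lemma eq_app k (f : op D k) b b' :
  (forall j, (1 <= j <= k)%N -> b j = b' j) -> app f b = app f b'.
Proof.
by move=> e; congr f; apply/ffunP => i; rewrite !ffunE e //= ltn_ord.
Qed.

Lemma multilinear_sum k (f : op D k) a j (I : Type) (r : seq I) (c : I -> K)
    (x : I -> D) : multilinear f ->
  f (subst_arg a j (\sum_(i <- r) c i *: x i)) =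
  \sum_(i <- r) c i *: f (subst_arg a j (x i)).
Proof.
move=> fl; elim: r => [|i r IH]; last by rewrite !big_cons fl IH.
rewrite !big_nil; apply: (multilinear0 (i := j) fl).
by rewrite ffunE eqxx.
Qed.

(* [f] applied to the sequence in which the block q, ..., q + l - 1 of [v] is
   replaced by [X]. *)
Definition replace_block l q (X : D) (v : nat -> D) j :=
  if j == q then X else v (expand l q j).

Lemma insert_atE k l q (f : op D k) (g : op D l) v :
  insert_at q f g v = app f (replace_block l q (app g (fun t => v (q + t - 1)%N)) v).
Proof.
apply: eq_app => j hj; rewrite /replace_block /expand.
by case: ltngtP => // ->; rewrite ltnn eqxx.
Qed.

Lemma app_replace_sum k l q (f : op D k) v (I : Type) (r : seq I) (c : I -> K)
    (x : I -> D) : multilinear f -> (1 <= q <= k)%N ->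
  app f (replace_block l q (\sum_(i <- r) c i *: x i) v) =
  \sum_(i <- r) c i *: app f (replace_block l q (x i) v).
Proof.
move=> fl hq; have [j ej] := perm_act_in hq.
have e X : app f (replace_block l q X v) =
    f (subst_arg [ffun i : 'I_k => v (expand l q i.+1)] j X).
  congr f; apply/ffunP => i; rewrite !ffunE /replace_block ej eqSS -(inj_eq val_inj).
  by [].
by rewrite e multilinear_sum //; apply: eq_bigr => i _; rewrite e.
Qed.

Lemma insert_at_sum k l q (f : op D k) (g : nat -> op D l) (R : seq nat) v :
  multilinear f -> (1 <= q <= k)%N ->
  insert_at q f (fun a => \sum_(t <- R) g t a) v =
  \sum_(t <- R) insert_at q f (g t) v.
Proof.
move=> fl hq; rewrite insert_atE /app.
transitivity (app f (replace_block l q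
  (\sum_(t <- R) 1 *: app (g t) (fun t => v (q + t - 1)%N)) v)).
  by congr (app f (replace_block l q _ v)); apply: eq_bigr => t _; rewrite scale1r.
rewrite app_replace_sum //; apply: eq_bigr => t _.
by rewrite scale1r insert_atE.
Qed.

(** Only letters outside the block are read, and there the blowup does not depend on [t]; hence [t]
    is arbitrary. *)
Lemma app_replace_blowup n k l p q (s : 'S_k) (t : 'S_l) (f : op D k) X v :
  (k + l = n + 1)%N -> (1 <= p <= k)%N -> (1 <= l)%N -> pa s p = q ->
  app f (replace_block l q X v \o pa s) =
  app f (replace_block l p X (v \o pa (blowup n p q s t))).
Proof.
move=> hn hp hl sp; apply: eq_app => j hj; rewrite /replace_block /=.
rewrite -{1}sp (inj_eq (@perm_act_inj _ s)); case: eqP => // /eqP jp.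
by rewrite blowup_out.
Qed.

Lemma app_inner_blowup n k l p q (s : 'S_k) (t : 'S_l) (g : op D l) v :
  (k + l = n + 1)%N -> (1 <= p <= k)%N -> (1 <= l)%N -> pa s p = q ->
  app g ((fun y => v (q + y - 1)%N) \o pa t) =
  app g (fun y => (v \o pa (blowup n p q s t)) (p + y - 1)%N).
Proof.
move=> hn hp hl sp; apply: eq_app => j hj /=.
by rewrite blowup_in.
Qed.

(** * Extension by additivity from homogeneous arguments *)

Lemma finite_ffun_val k (L : seq int) :
  finite_set [set d : {ffun 'I_k -> int} | forall i, d i \in L]%classic.
Proof.
apply: (@sub_finite_set _ _
  ((fun g : {ffun 'I_k -> 'I_(size L)} => [ffun i => nth 0 L (g i)])
    @` [set: {ffun 'I_k -> 'I_(size L)}])%classic).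
  move=> d /= dL; have lt i : (index (d i) L < size L)%N by rewrite index_mem.
  exists [ffun i => Ordinal (lt i)] => //; apply/ffunP => i.
  by rewrite !ffunE /= nth_index.
exact: finite_image finite_finset.
Qed.

(** By multilinearity a nonzero term needs every [hcomp D (d i) (a i)] nonzero, and each argument
    has finitely many nonzero components. *)
Lemma hextend_finite k (f : {ffun 'I_k -> int} -> op D k) (a : {ffun 'I_k -> D}) :
  (forall d, multilinear (f d)) ->
  finite_set [set d | f d [ffun i => hcomp D (d i) (a i)] != 0]%classic.
Proof.
move=> fl.
have /choice[L hL] (i : 'I_k) : exists s : seq int,
    [set e | hcomp D e (a i) != 0]%classic = [set` s]%classic.
  exact/finite_seqP/hcomp_finite.
apply: sub_finite_set (finite_ffun_val k (flatten [seq L i | i <- enum 'I_k])).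
move=> d /= fd i; apply/flattenP; exists (L i); first by rewrite map_f ?mem_enum.
have : [set` L i]%classic (d i); last by [].
rewrite -hL /=; apply: contraNN fd => /eqP e.
by apply/eqP; apply: (multilinear0 (i := i)) => //; rewrite ffunE.
Qed.

Lemma hextend_multilinear k (f : {ffun 'I_k -> int} -> op D k) :
  (forall d, multilinear (f d)) -> multilinear (hextend f).
Proof.
move=> fl a j c x y.
have hcE d z : [ffun i => hcomp D (d i) (subst_arg a j z i)] =
    subst_arg [ffun i => hcomp D (d i) (a i)] j (hcomp D (d j) z).
  by apply/ffunP => i; rewrite !ffunE; case: eqP => [->|].
pose S z := [set d | f d [ffun i => hcomp D (d i) (subst_arg a j z i)] != 0]%classic.
have Sfin z : finite_set (S z) by apply: hextend_finite.
(* A common finite support for the three sums, so that linearity can be checked term by term. *)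
pose U := (S (c *: x + y)%R `|` (S x `|` S y))%classic.
have Ufin : finite_set U by rewrite !finite_setU.
have hE z : (S z `<=` U)%classic -> hextend f (subst_arg a j z) =
    \sum_(d <- finmap.enum_fset (fset_set U))
      f d [ffun i => hcomp D (d i) (subst_arg a j z i)].
  move=> zU; rewrite /hextend -(fsbig_widen U) //=; first by rewrite fsbig_finite.
  move=> d [_ /= dU]; apply/eqP/negPn/negP => h; apply: dU; exact: zU.
rewrite !hE; [|by move=> d h; rewrite /U; right; (left + right)..|by left].
rewrite scaler_sumr -big_split; apply: eq_bigr => d _ /=.
by rewrite !hcE linearP fl.
Qed.

(** * The operations theta *)

Section Theta.
Variables (mu : forall k, nat -> op D k).
Arguments mu : clear implicits.
Hypothesis muP : dend_infty1 mu.

Local Notation theta k := (@theta_of_dend K D mu k).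
Local Notation sg z := ((-1 : K) ^ z%R).

Lemma thetaE k d b : (1 <= k)%N -> homog_upto k d b ->
  app (theta k) b =
  \sum_(s : 'S_k) koszul_nat K k (pa s) d *:
     app (mu k (pa s^-1%g k)) (b \o pa s).
Proof.
case: k => // m _ hb; rewrite /app.
rewrite (@theta_of_dendE _ _ _ _ [ffun i : 'I_m.+1 => d i.+1] _ muP).
  apply: eq_bigr => s _; congr (_ *: _).
    by apply: koszulE => i; rewrite ffunE.
  rewrite (perm_act_ord _ ord_max); congr (mu _ _).
  by apply/ffunP => i; rewrite !ffunE /= perm_act_ord.
by move=> i; rewrite !ffunE; apply: hb; rewrite /= ltn_ord.
Qed.

Lemma theta_multilinear k : (1 <= k)%N -> multilinear (theta k).
Proof.
case: k => // m _; apply: hextend_multilinear => d a j c x y.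
rewrite scaler_sumr -big_split; apply: eq_bigr => s _ /=.
have e z : [ffun i => subst_arg a j z (s i)] =
    subst_arg [ffun i => a (s i)] (s^-1%g j) z :> {ffun 'I_m.+1 -> D}.
  apply/ffunP => i; rewrite !ffunE.
  by rewrite -{1}(permKV s j) (inj_eq perm_inj).
rewrite !e (dend_multilinear muP); last by rewrite /= ltn_ord.
by rewrite scalerDr !scalerA mulrC.
Qed.

Lemma theta_homog k d b : (1 <= k)%N -> homog_upto k d b ->
  homog (1 + \sum_(1 <= i < k.+1) d i) (app (theta k) b).
Proof.
move=> hk hb; rewrite (thetaE hk hb); apply: homog_sum => s _; apply: homogZ.
rewrite -(big_perm_act _ s) big_nat_ord.
apply: (dend_degree muP); first by rewrite perm_act_range hk leqnn.
by move=> i; rewrite ffunE; apply: hb; rewrite perm_act_range /= ltn_ord.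
Qed.

Lemma theta_degree k : (1 <= k)%N -> degree_one (theta k).
Proof.
move=> hk d a ha.
(* Sequences indexed from 1 that extend the finite families, as [theta_homog] requires. *)
pose d' j := if insub j.-1 is Some i then d i else 0.
pose b j := if insub j.-1 is Some i then a i else 0.
have d'E (i : 'I_k) : d' i.+1 = d i by rewrite /d' /= valK.
have bE (i : 'I_k) : b i.+1 = a i by rewrite /b /= valK.
have hb : homog_upto k d' b.
  by move=> j /perm_act_in[i ->]; rewrite d'E bE; apply: ha.
have := theta_homog hk hb; rewrite big_nat_ord /app.
rewrite (eq_bigr d) => [|i _]; last by rewrite d'E.
by congr (homog _ (_ _)); apply/ffunP => i; rewrite ffunE bE.
Qed.

(** Reindexing by right multiplication with [s] and the cocycle rule; the labels are unchanged
    because [s] fixes k. *)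
Lemma theta_sym k d b (s : 'S_k) : (1 <= k)%N -> homog_upto k d b ->
  pa s k = k ->
  app (theta k) b = koszul_nat K k (pa s) d *: app (theta k) (b \o pa s).
Proof.
move=> hk hb sk; have hb' : homog_upto k (d \o pa s) (b \o pa s).
  by move=> j hj; apply: hb; rewrite perm_act_range.
rewrite (thetaE hk hb) (thetaE hk hb') scaler_sumr.
rewrite (reindex_inj (mulIg s)); apply: eq_bigr => t _ /=.
rewrite scalerA -koszul_natM; congr (_ *: _).
have -> : pa (t * s)^-1%g k = pa t^-1%g k.
  rewrite invMg perm_actM (_ : pa s^-1%g k = k) //.
  by apply: (@perm_act_inj _ s); rewrite perm_actKV.
by congr (app _ _); apply/funext => x; rewrite /= perm_actM.
Qed.

End Theta.
End Graded.

(** * The pre-Lie identity *)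

Section Main.
Variables (K : fieldType) (D : gradedSpace K) (mu : forall k, nat -> op D k).
Arguments mu : clear implicits.
Hypotheses (charK : [pchar K] =i pred0) (muP : dend_infty1 mu).

Local Notation theta k := (@theta_of_dend K D mu k).
Local Notation sg z := ((-1 : K) ^ z%R).

(* The operation [g], of degree one, has to pass the first q - 1 letters. *)
Definition signed_insert k l q (f : op D k) (g : op D l) (d : nat -> int)
    (v : nat -> D) : D :=
  sg (\sum_(1 <= x < q) d x) *: insert_at q f g v.

Lemma homog_replace k l n q d (X : D) v :
  (k + l = n + 1)%N -> (1 <= q <= k)%N -> (1 <= l)%N -> homog_upto n d v ->
  homog (1 + \sum_(1 <= t < l.+1) d (q + t - 1)%N) X ->
  homog_upto k (block_degree l q d) (replace_block l q X v).
Proof.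
move=> hn hq hl hv hX j hj; rewrite /block_degree /replace_block; case: eqP => // jq.
by apply: hv; rewrite /expand; case: ifP; lia.
Qed.

Lemma homog_perm n (s : 'S_n) d (v : nat -> D) :
  homog_upto n d v -> homog_upto n (d \o pa s) (v \o pa s).
Proof. by move=> hv i hi; apply: hv; rewrite perm_act_range. Qed.

(** * Insertion of one theta into another at fixed arities *)

Section Arity.
Variables (n k l q : nat).
Hypotheses (hn : (k + l = n + 1)%N) (hq : (1 <= q <= k)%N) (hl : (1 <= l)%N).

Let hk : (1 <= k)%N. Proof. by lia. Qed.

Lemma insert_theta d v : homog_upto n d v ->
  signed_insert q (theta k) (theta l) d v =
  \sum_(s : 'S_k) \sum_(t : 'S_l)
    let p := pa s^-1%g q in let b := blowup n p q s t in
    koszul_nat K n (pa b) d *: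
      signed_insert p (mu k (pa s^-1%g k)) (mu l (pa t^-1%g l))
        (d \o pa b) (v \o pa b).
Proof.
move=> hv; set w := fun t => v (q + t - 1)%N.
have hw : homog_upto l (fun t => d (q + t - 1)%N) w.
  by move=> t ht; apply: hv; lia.
have hX := theta_homog muP hl hw.
rewrite /signed_insert insert_atE (thetaE muP hk (homog_replace hn hq hl hv hX)).
rewrite scaler_sumr; apply: eq_bigr => s _.
set p := pa s^-1%g q; have sp : pa s p = q by rewrite perm_actKV.
have hp : (1 <= p <= k)%N by rewrite perm_act_range.
have fl : multilinear (mu k (pa s^-1%g k)).
  by apply: (dend_multilinear muP); rewrite perm_act_range hk leqnn.
(* [1%g] is a placeholder for the inner permutation, which appears only once the inner operation is
   expanded; it is replaced by [t] below. *)
rewrite (app_replace_blowup 1%g _ _ _ hn hp hl sp) (thetaE muP hl hw).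
rewrite app_replace_sum // !scaler_sumr; apply: eq_bigr => t _ /=.
rewrite insert_atE (app_inner_blowup _ _ _ hn hp hl sp).
rewrite -(app_replace_blowup 1%g _ _ _ hn hp hl sp).
rewrite (app_replace_blowup t _ _ _ hn hp hl sp) !scalerA; congr (_ *: _).
rewrite ?mulrA; exact: koszul_blowup.
Qed.

(** Source of the invariance under the Young subgroup: both operations are symmetric in all but
    their last argument, and [s] keeps the inner operation in its slot. *)
Lemma insert_theta_sym d v (s : 'S_k) (t : 'S_l) : homog_upto n d v ->
  s \in fix2 k q -> t \in fix2 l l -> let b := blowup n q q s t in
  signed_insert q (theta k) (theta l) d v =
  koszul_nat K n (pa b) d *:
    signed_insert q (theta k) (theta l) (d \o pa b) (v \o pa b).
Proof.
move=> hv /fix2P[sq sk] /fix2P[tl _] /=; set w := fun t => v (q + t - 1)%N.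
have hw : homog_upto l (fun t => d (q + t - 1)%N) w.
  by move=> x hx; apply: hv; lia.
have hX := theta_homog muP hl hw.
rewrite /signed_insert insert_atE.
rewrite (theta_sym muP hk (homog_replace hn hq hl hv hX) sk).
rewrite (app_replace_blowup t _ _ _ hn hq hl sq) (theta_sym muP hl hw tl).
rewrite (app_inner_blowup _ _ _ hn hq hl sq).
set X := app (theta l) _; set c := koszul_nat K l _ _.
(* A one-term sum, so that linearity in slot q extracts the scalar. *)
have -> : c *: X = \sum_(i <- [:: tt]) c *: X by rewrite big_seq1.
rewrite app_replace_sum //; last exact: theta_multilinear.
rewrite big_seq1 insert_atE !scalerA; congr (_ *: _).
rewrite ?mulrA; exact: koszul_blowup.
Qed.

(* Position in a_1 ... f(...) ... of the last letter, when the last argument of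
   the outer operation is its m-th one, and the last argument of the inner
   operation its r-th one. *)
Definition last_pos p m r := if q == k then (p + r - 1)%N else expand l p m.

(** The letter n is the last one of the inner block if q = k, and the last outer letter
    otherwise. *)
Lemma blowup_last (s : 'S_k) (t : 'S_l) :
  pa (blowup n (pa s^-1%g q) q s t)^-1%g n =
  last_pos (pa s^-1%g q) (pa s^-1%g k) (pa t^-1%g l).
Proof.
set p := pa s^-1%g q; have sp : pa s p = q by rewrite perm_actKV.
have hp : (1 <= p <= k)%N by rewrite perm_act_range.
apply: (@perm_act_inj _ (blowup n p q s t)); rewrite perm_actKV /last_pos.
case: eqP => [qk|/eqP qk].
  by rewrite blowup_in // ?perm_actKV ?perm_act_range ?hl ?leqnn //; lia.
rewrite blowup_out // ?perm_actKV ?perm_act_range ?hk ?leqnn //.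
  by rewrite /expand ifF; lia.
by rewrite (inj_eq (@perm_act_inj _ _)) eq_sym.
Qed.

Lemma sum_insert_theta d v : homog_upto n d v ->
  \sum_(s : 'S_n | pa s n == n)
    koszul_nat K n (pa s) d *:
      signed_insert q (theta k) (theta l) (d \o pa s) (v \o pa s) =
  (\sum_(s : 'S_n) koszul_nat K n (pa s) d *:
    \sum_(1 <= p < k.+1) \sum_(1 <= m < k.+1 | (p == m) == (q == k))
      \sum_(1 <= r < l.+1 | last_pos p m r == pa s^-1%g n)
        signed_insert p (mu k m) (mu l r) (d \o pa s) (v \o pa s))
  *+ (#|fix2 k q| * #|fix2 l l|).
Proof.
move=> hv.
(* The contribution of outer slot p with labels m and r; the permutations [a] and [b] matter only
   through these three numbers. *)
pose E p m r := \sum_(s : 'S_n | last_pos p m r == pa s^-1%g n)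
  koszul_nat K n (pa s) d *:
    signed_insert p (mu k m) (mu l r) (d \o pa s) (v \o pa s).
transitivity (\sum_(a : 'S_k) \sum_(b : 'S_l)
   E (pa a^-1%g q) (pa a^-1%g k) (pa b^-1%g l)).
  under eq_bigr => s _ do rewrite (insert_theta (homog_perm s hv)) scaler_sumr.
  rewrite exchange_big; apply: eq_bigr => a _.
  under eq_bigr => s _ do rewrite scaler_sumr.
  rewrite exchange_big; apply: eq_bigr => b _ /=; rewrite /E.
  set B := blowup _ _ _ _ _.
  (* Left multiplication by [B] turns the condition that n is fixed into a prescribed preimage of
     n. *)
  rewrite [RHS](reindex_inj (mulgI B)); apply: eq_big => s.
    by rewrite -blowup_last -/B eq_sym -perm_act_eqV perm_actM perm_actKV.
  move=> _; rewrite scalerA -koszul_natM; congr (_ *: signed_insert _ _ _ _ _).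
    by apply/funext => x /=; rewrite perm_actM.
  by apply/funext => x /=; rewrite perm_actM.
transitivity ((\sum_(1 <= p < k.+1) \sum_(1 <= m < k.+1 | (p == m) == (q == k))
   \sum_(1 <= r < l.+1) E p m r) *+ (#|fix2 k q| * #|fix2 l l|)).
  under eq_bigr => a _ do rewrite (sum_perm_act1 (E _ _)) //.
  rewrite sumrMnl (sum_perm_act2 (fun p m => \sum_(1 <= r < l.+1) E p m r)) //.
  by rewrite mulrnA.
congr (_ *+ _); rewrite /E; under [RHS]eq_bigr => s _ do rewrite scaler_sumr.
rewrite [RHS]exchange_big; apply: eq_bigr => p _ /=.
under [RHS]eq_bigr => s _ do rewrite scaler_sumr.
rewrite [RHS]exchange_big; apply: eq_bigr => m _ /=.
under [RHS]eq_bigr => s _ do rewrite scaler_sumr big_mkcond.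
rewrite [RHS]exchange_big; apply: eq_bigr => r _ /=.
by rewrite big_mkcond.
Qed.

End Arity.

(** * Sums over shuffles and the dendriform identity *)

Lemma mulrn_inj (x y : D) N : (0 < N)%N -> x *+ N = y *+ N -> x = y.
Proof.
move=> N0; rewrite -(scaler_nat N x) -(scaler_nat N y); apply: scalerI.
by have /pcharf0P -> := charK; rewrite -lt0n.
Qed.

Lemma fix2_gt0 k q : (0 < #|fix2 k q|)%N.
Proof. by apply/card_gt0P; exists 1%g; apply/fix2P; rewrite !perm_act1. Qed.

(** Both sides are compared after multiplication by one number, which is the order of the Young
    subgroup on the left and the multiplicity in [sum_insert_theta] on the right. *)
Lemma shuffle_insert_theta n k l q c d v :
  (k + l = n.+1 + 1)%N -> (1 <= q <= k)%N -> (1 <= l)%N ->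
  homog_upto n.+1 d v ->
  (forall x y, (x < n)%N -> (y < n)%N ->
     (reshape_index c x == reshape_index c y) =
     (block_label n.+1 l q x.+1 == block_label n.+1 l q y.+1)) ->
  \sum_(s : 'S_n | shuffle c s)
    koszul_nat K n (pa s) d *:
      signed_insert q (theta k) (theta l) (d \o pa s) (v \o pa s) =
  \sum_(s : 'S_n.+1) koszul_nat K n.+1 (pa s) d *:
    \sum_(1 <= p < k.+1) \sum_(1 <= m < k.+1 | (p == m) == (q == k))
      \sum_(1 <= r < l.+1 | last_pos k l q p m r == pa s^-1%g n.+1)
        signed_insert p (mu k m) (mu l r) (d \o pa s) (v \o pa s).
Proof.
move=> hn hq hl hv hc.
apply: (@mulrn_inj _ _ (#|fix2 k q| * #|fix2 l l|)).
  by rewrite muln_gt0 !fix2_gt0.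
rewrite -(sum_insert_theta hn hq hl hv).
rewrite (sum_shuffle_lift (fun f => koszul_nat K n f d *:
   signed_insert q (theta k) (theta l) (d \o f) (v \o f)) hc); last first.
  move=> x hx; apply/eqP => -[_ _]; rewrite eqxx; lia.
rewrite big_mkcondr /= -(card_young_blowup hn hq hl).
(* Extension by zero off the stabiliser of n + 1 makes [G] invariant on the whole group. *)
set G := fun s : 'S_n.+1 => if pa s n.+1 == n.+1 then
  koszul_nat K n.+1 (pa s) d *:
      signed_insert q (theta k) (theta l) (d \o pa s) (v \o pa s) else 0.
rewrite [LHS](_ : _ = (\sum_(s | block_shuffle
   (fun i : 'I_n.+1 => block_label n.+1 l q i.+1) s) G s) *+
   #|young (fun i : 'I_n.+1 => block_label n.+1 l q i.+1)|); last first.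
  congr (_ *+ _); apply: eq_bigr => s _; rewrite /G; case: eqP => // sn.
  rewrite koszul_nat_stable // => x hx.
  have := perm_act_range s x; have := perm_act_fixE x sn.
  have -> : (1 <= x <= n.+1)%N by lia.
  by lia.
rewrite -sum_block_shuffle; first by rewrite /G -big_mkcond.
move=> y s yY; rewrite /G.
have [a [b [ha hb ey]]] := young_blowup hn hq hl yY.
have yn : pa y n.+1 = n.+1.
  have /youngP/(_ ord_max) := yY; rewrite -perm_act_ord /= => -[_ _].
  by rewrite eqxx => /eqP.
rewrite perm_actM yn; case: ifP => // _.
have := insert_theta_sym hn hq hl (homog_perm s hv) ha hb => /= ->.
rewrite -ey scalerA -koszul_natM; congr (_ *: signed_insert _ _ _ _ _).
  by apply/funext => x /=; rewrite perm_actM.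
by apply/funext => x /=; rewrite perm_actM.
Qed.

(** If r0 lies in the block at p, the outer label is p and only the second sum contributes, by one
    term; otherwise the outer label differs from p, the inner one is free, and only the first sum
    contributes. For k = 1 the slots 1 and k coincide, so the first sum is left out. *)
Lemma dend_term_split n k l r0 d v :
  (k + l = n + 1)%N -> (1 <= k)%N -> (1 <= l)%N -> (1 <= r0 <= n)%N ->
  \sum_(1 <= p < k.+1) sg (\sum_(1 <= x < p) d x) *:
     insert_at p (mu k (labelR0 l p r0))
       (sum_labels mu (l := l) (labelRi l p r0)) v =
  (if (2 <= k)%N then
    \sum_(1 <= p < k.+1) \sum_(1 <= m < k.+1 | (p == m) == (1%N == k))
      \sum_(1 <= r < l.+1 | last_pos k l 1 p m r == r0)
        signed_insert p (mu k m) (mu l r) d v else 0) +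
  \sum_(1 <= p < k.+1) \sum_(1 <= m < k.+1 | (p == m) == (k == k))
    \sum_(1 <= r < l.+1 | last_pos k l k p m r == r0)
      signed_insert p (mu k m) (mu l r) d v.
Proof.
move=> hn hk hl hr.
transitivity (\sum_(1 <= p < k.+1) ((if (2 <= k)%N then
  \sum_(1 <= m < k.+1 | (p == m) == (1%N == k))
      \sum_(1 <= r < l.+1 | last_pos k l 1 p m r == r0)
        signed_insert p (mu k m) (mu l r) d v else 0) +
  \sum_(1 <= m < k.+1 | (p == m) == (k == k))
    \sum_(1 <= r < l.+1 | last_pos k l k p m r == r0)
      signed_insert p (mu k m) (mu l r) d v)); last first.
  by rewrite big_split /=; case: ifP => // _; rewrite big1_eq.
apply: eq_big_nat => p hp.
rewrite (eqxx k) [X in _ + X](eq_bigl (pred1 p)); last first.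
  by move=> m; rewrite eqb_id eq_sym.
rewrite big_nat1_eq hp /last_pos eqxx /labelR0 /labelRi.
have R0P : (1 <= labelR0 l p r0 <= k)%N.
  by rewrite /labelR0; do 2?case: ifP; lia.
rewrite insert_at_sum; [|exact: (dend_multilinear muP)|lia].
case: (boolP (p <= r0 < p + l)%N) => hin.
  rewrite [X in X + _](_ : _ = 0); last first.
    case: ifP => // k2; rewrite big1_seq // => m /andP[pm _].
    rewrite big_pred0 // => r; move: pm; rewrite (_ : (1%N == k) = false); last by lia.
    by rewrite /expand; case: ifP; lia.
  rewrite add0r big_seq1 [RHS](eq_bigl (pred1 (r0 - p + 1)%N)); last first.
    by move=> r /=; lia.
  rewrite [RHS]big_nat1_eq [RHS]ifT; last by lia.
  have [-> ->] : (r0 < p)%N = false /\ (r0 < p + l)%N by lia.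
  by [].
rewrite [X in _ + X]big_nat_cond [X in _ + X]big_pred0; last first.
  by move=> r; lia.
(* For k = 1 the block would contain every position, r0 included. *)
have k2 : (2 <= k)%N by lia.
rewrite addr0 k2 /= (_ : (1%N == k) = false); last by lia.
rewrite [RHS]big_mkcond [RHS](eq_big_nat _ _ (F2 := fun m => if m == labelR0 l p r0 then
   \sum_(1 <= r < l.+1) signed_insert p (mu k m) (mu l r) d v else 0)).
  rewrite -[RHS]big_mkcond [RHS]big_nat1_eq [RHS]ifT; last by lia.
  by rewrite scaler_sumr /index_iota (_ : (l.+1 - 1 = l)%N) //; lia.
move=> m hm; have e : (p != m) && (expand l p m == r0) = (m == labelR0 l p r0).
  by rewrite /labelR0 /expand; do 3?case: ifP; lia.
rewrite -e; case: (eqVneq p m) => //= _.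
by case: eqP => // _; rewrite big_pred0.
Qed.

Lemma reshape_index2 a b x : (x < a + b)%N ->
  reshape_index [:: a; b] x = (a <= x)%N.
Proof.
move=> hx; rewrite /reshape_index /=.
by case: leqP => h; [rewrite ifF ?ifT | rewrite ifT]; lia.
Qed.

Lemma reshape_index3 a b x : (x < a + 1 + b)%N ->
  reshape_index [:: a; 1; b]%N x = (if x < a then 0 else if x == a then 1 else 2)%N.
Proof.
move=> hx; rewrite /reshape_index /=.
by do 4?case: eqP; case: ltngtP; lia.
Qed.

Lemma theta_pre_lie_identity n d (v : nat -> D) : (1 <= n)%N -> homog_upto n d v ->
    \sum_(1 <= i < n.+1) \sum_(2 <= j < n.+1 | (i + j == n + 1)%N)
      \sum_(s : 'S_n.-1 | shuffle [:: i - 1; 1; j - 2]%N s)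
        koszul K s (fun x => d x.+1) *:
          insert_at 1 (theta j) (theta i) (v \o pa s)
    + \sum_(1 <= i < n.+1) \sum_(1 <= j < n.+1 | (i + j == n + 1)%N)
      \sum_(s : 'S_n.-1 | shuffle [:: j - 1; i - 1]%N s)
        (sg (\sum_(1 <= t < j) d (pa s t)) * koszul K s (fun x => d x.+1)) *:
          insert_at j (theta j) (theta i) (v \o pa s) = 0.
Proof.
case: n => // n _ hv /=.
(* The contribution of [s] when the inner operation sits in slot q; [A] collects slot 1 and [B] slot
   k. *)
pose W q k l (s : 'S_n.+1) :=
  \sum_(1 <= p < k.+1) \sum_(1 <= m < k.+1 | (p == m) == (q == k))
    \sum_(1 <= r < l.+1 | last_pos k l q p m r == pa s^-1%g n.+1)
      signed_insert p (mu k m) (mu l r) (d \o pa s) (v \o pa s).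
pose A k l := \sum_(s : 'S_n.+1) koszul_nat K n.+1 (pa s) d *:
  (if (2 <= k)%N then W 1%N k l s else 0).
pose B k l := \sum_(s : 'S_n.+1) koszul_nat K n.+1 (pa s) d *: W k k l s.
transitivity (\sum_(1 <= i < n.+2) \sum_(1 <= j < n.+2 | (i + j == n.+1 + 1)%N)
    (A j i + B j i)).
  rewrite -big_split; apply: eq_big_nat => i hi /=; rewrite big_split /=.
  congr (_ + _).
    (* The lower bound 2 on the outer arity becomes the case distinction in [A]. *)
    rewrite (@big_nat_widenl _ _ _ 2 1) // big_mkcondr /=.
    rewrite [LHS]big_nat_cond [RHS]big_nat_cond.
    apply: eq_bigr => j /andP[hj /eqP ij]; rewrite /A.
    case: ifP => j2; last by rewrite big1 // => s _; rewrite scaler0.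
    rewrite -(@shuffle_insert_theta n j i 1 [:: i - 1; 1; j - 2]%N d v) //; try lia.
      apply: eq_bigr => s _; rewrite (@koszulE K _ s _ d) // /signed_insert.
      by rewrite big_geq // expr0z scale1r.
    move=> x y hx hy; rewrite /block_label !xpair_eqE !reshape_index3; try lia.
    by do 2?[case: ltngtP => ?]; lia.
  rewrite [LHS]big_nat_cond [RHS]big_nat_cond.
  apply: eq_bigr => j /andP[hj /eqP ij]; rewrite /B.
  rewrite -(@shuffle_insert_theta n j i j [:: j - 1; i - 1]%N d v) //; try lia.
    apply: eq_bigr => s _; rewrite (@koszulE K _ s _ d) // /signed_insert.
    by rewrite scalerA mulrC.
  move=> x y hx hy; rewrite /block_label !xpair_eqE !reshape_index2; lia.
(* The pre-Lie sums run over the inner arity first, the dendriform ones over the outer arity. *)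
rewrite (exchange_big_dep_nat xpredT) //=.
transitivity (\sum_(s : 'S_n.+1) koszul_nat K n.+1 (pa s) d *:
  \sum_(1 <= k < n.+2) \sum_(1 <= l < n.+2 | (k + l == n.+1 + 1)%N)
      \sum_(1 <= i < k.+1)
        sg (\sum_(1 <= t < i) (d \o pa s) t) *:
          insert_at i (mu k (labelR0 l i (pa s^-1%g n.+1)))
            (sum_labels mu (l := l) (labelRi l i (pa s^-1%g n.+1))) (v \o pa s)).
  under [RHS]eq_bigr => s _ do rewrite scaler_sumr.
  rewrite [RHS]exchange_big; apply: eq_big_nat => k hk /=.
  under [RHS]eq_bigr => s _ do rewrite scaler_sumr.
  rewrite [RHS]exchange_big [LHS]big_nat_cond [RHS]big_nat_cond.
  apply: eq_big => [l|l]; first by rewrite addnC.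
  case/andP=> hl /eqP kl; rewrite /A /B -big_split; apply: eq_bigr => s _ /=.
  rewrite -scalerDr (@dend_term_split n.+1) //; try lia.
  by rewrite perm_act_range ltnSn.
(* The dendriform identity for the letters permuted by [s], with r the position of the last
   letter. *)
rewrite big1 // => s _; rewrite (dend_identity muP) ?scaler0 //.
  by rewrite perm_act_range ltnSn.
exact: homog_perm.
Qed.

End Main.

Theorem theorem7p9 (K : fieldType) (charK : [pchar K] =i pred0)
    (D : gradedSpace K) (mu : forall k, nat -> op D k) :
  dend_infty1 mu -> pre_lie_infty1 (theta_of_dend mu).
Proof.
move=> muP; split.
- by move=> k; apply: theta_multilinear.
- by move=> k; apply: theta_degree.
- case=> // k d v s hk hv; rewrite (@koszulE K _ s _ d) //=.
  (* Symmetry in the first k arguments: [s] is viewed in ['S_k.+1], fixing the last letter. *)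
  have sk : pa s k.+1 = k.+1 by rewrite perm_act_out.
  have e := perm_of_fun_up s (leqnSn k).
  rewrite (theta_sym muP (s := perm_of_fun k.+1 (pa s)) hk hv) ?e //.
  congr (_ *: _); apply: koszul_nat_stable => // x hx.
  by have := perm_act_range s x; rewrite hx => /andP[].
- by move=> n d v hn hv; apply: theta_pre_lie_identity.
Qed.
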